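(* There is an absolute constant $c>0$ such that the following holds. Let $n,d$ be positive integers. For each $h\in\{1,\ldots,d\}$, let $k_h$ be a positive integer with $k_h\le\lfloor\frac{n-1}{2}\rfloor$, and let $X_h=X(\mathbb{Z}_n,\{\pm1,\ldots,\pm k_h\})$ be the circulant graph. 1. Let $X=X_1\square\cdots\square X_d$ be the Cartesian product. Then one can partition the edge set of $X$ into $E_1\cup E_2$, in polynomial time, such that the two edge-induced subgraphs $G_1,G_2$ (on the vertex set of $X$, with edge sets $E_1,E_2$) satisfy $$-\frac{c}{\sqrt{k_{\min}}}\,L_X\preccurlyeq L_{G_1}-L_{G_2}\preccurlyeq\frac{c}{\sqrt{k_{\min}}}\,L_X,\qquad\text{where } k_{\min}=\min_{1\le h\le d}k_h.$$ 2. Let $X=X_1\times\cdots\times X_d$ be the tensor product. Then one can partition the edge set of $X$ into $E_1\cup E_2$, in polynomial time, such that the two edge-induced subgraphs $G_1,G_2$ (on the vertex set of $X$, with edge sets $E_1,E_2$) satisfy $$-\frac{c^d}{\sqrt{K}}\,L_X\preccurlyeq L_{G_1}-L_{G_2}\preccurlyeq\frac{c^d}{\sqrt{K}}\,L_X,\qquad\text{where } K=\prod_{h=1}^d k_h.$$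
   Context: $\mathbb{Z}_n$ is the additive group of integers modulo $n$. For a symmetric set $S\subseteq\mathbb{Z}_n\setminus\{0\}$ (i.e. $x\in S\iff -x\in S$), the circulant graph $X(\mathbb{Z}_n,S)$ is the undirected graph with vertex set $\mathbb{Z}_n$ in which $i,j$ are adjacent iff $i-j\in S$. For undirected graphs $G_1=(V_1,E_1)$ and $G_2=(V_2,E_2)$, the Cartesian product $G_1\square G_2$ has vertex set $V_1\times V_2$ and edge set $\{((a_1,a_2),(b_1,b_2)): a_1=b_1,(a_2,b_2)\in E_2\text{ or }(a_1,b_1)\in E_1,a_2=b_2\}$; the tensor product $G_1\times G_2$ has vertex set $V_1\times V_2$ and edge set $\{((a_1,a_2),(b_1,b_2)):(a_1,b_1)\in E_1,(a_2,b_2)\in E_2\}$. Products of $d$ graphs are obtained by iterating. The Laplacian of a graph $G=(V,E)$ is $L_G=\sum_{(u,v)\in E}(\chi_u-\chi_v)(\chi_u-\chi_v)^\top$, where $\chi_u\in\mathbb{R}^V$ is the indicator vector of $u$ and each undirected edge is counted once. For symmetric real matrices, $A\preccurlyeq B$ means that $B-A$ is positive semidefinite. *)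

(* Defs.v *)
From HB Require Import structures.
From mathcomp Require Import all_boot all_order all_algebra.
From mathcomp Require Import reals.

Set Implicit Arguments.
Unset Strict Implicit.
Unset Printing Implicit Defensive.

Import Order.TTheory GRing.Theory Num.Theory.
Local Open Scope ring_scope.

Record sgraph := SGraph {
  vert :> finType;
  adj : rel vert;
  adj_sym : symmetric adj;
  adj_irr : irreflexive adj }.

Definition edges (G : sgraph) : {set {set G}} :=
  [set e | [exists u : G, exists v : G, adj u v && (e == [set u; v])]].

Section Circulant.
Variables (n : nat) (S : {set 'Z_n}).
Hypothesis S_sym : forall x, (- x \in S) = (x \in S).
Hypothesis S_0 : 0 \notin S.

Definition circulant_rel : rel 'Z_n := fun i j => i - j \in S.

Lemma circulant_sym : symmetric circulant_rel.
Proof. by move=> i j; rewrite /circulant_rel -S_sym opprB. Qed.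

Lemma circulant_irr : irreflexive circulant_rel.
Proof. by move=> i; rewrite /circulant_rel subrr (negPf S_0). Qed.

Definition circulant : sgraph := SGraph circulant_sym circulant_irr.
End Circulant.

(* The set {+-1, ..., +-k}.  For 1 < n the condition x != 0 is redundant as
   soon as k < n; it makes the graph below well defined for all n and k. *)
Definition pm_set (n k : nat) : {set 'Z_n} :=
  [set x | (x != 0) && has (fun j => (x == j%:R) || (x == - j%:R)) (iota 1 k)].

Lemma pm_set_sym n k (x : 'Z_n) : (- x \in pm_set n k) = (x \in pm_set n k).
Proof.
rewrite !inE oppr_eq0; congr (_ && _); apply: eq_has => j.
by rewrite eqr_opp eqr_oppLR orbC.
Qed.

Lemma pm_set_0 n k : (0 : 'Z_n) \notin pm_set n k.
Proof. by rewrite inE eqxx. Qed.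

Definition pm_circulant (n k : nat) : sgraph :=
  circulant (@pm_set_sym n k) (@pm_set_0 n k).

Section Products.
Variables G1 G2 : sgraph.

Definition cart_rel : rel (G1 * G2)%type := fun a b =>
  ((a.1 == b.1) && adj a.2 b.2) || (adj a.1 b.1 && (a.2 == b.2)).

Lemma cart_sym : symmetric cart_rel.
Proof.
move=> a b; rewrite /cart_rel (adj_sym a.1) (adj_sym a.2).
by rewrite (eq_sym a.1) (eq_sym a.2).
Qed.

Lemma cart_irr : irreflexive cart_rel.
Proof. by move=> a; rewrite /cart_rel !adj_irr andbF. Qed.

Definition cart_prod : sgraph := SGraph cart_sym cart_irr.

Definition tensor_rel : rel (G1 * G2)%type := fun a b =>
  adj a.1 b.1 && adj a.2 b.2.

Lemma tensor_sym : symmetric tensor_rel.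
Proof. by move=> a b; rewrite /tensor_rel (adj_sym a.1) (adj_sym a.2). Qed.

Lemma tensor_irr : irreflexive tensor_rel.
Proof. by move=> a; rewrite /tensor_rel adj_irr. Qed.

Definition tensor_prod : sgraph := SGraph tensor_sym tensor_irr.
End Products.

Lemma no_edge_sym : symmetric (fun _ _ : unit => false). Proof. by []. Qed.
Lemma no_edge_irr : irreflexive (fun _ _ : unit => false). Proof. by []. Qed.
Definition one_vertex : sgraph := SGraph no_edge_sym no_edge_irr.

(* (..(G_1 op G_2) op ..) op G_d; the value on the empty list is irrelevant. *)
Definition iter_prod (op : sgraph -> sgraph -> sgraph) (s : seq sgraph) :
    sgraph :=
  if s is G :: s' then foldl op G s' else one_vertex.

Section Laplacian.
Variables (R : realType) (V : finType).

Definition chi (u : V) : 'cV[R]_#|V| := delta_mx (enum_rank u) 0.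

(* The Laplacian of the graph with vertex set V and edge set E; the condition
   on ranks picks one orientation of each edge, so that it is counted once. *)
Definition laplacian (E : {set {set V}}) : 'M[R]_#|V| :=
  \sum_(u : V) \sum_(v : V | (enum_rank u < enum_rank v)%N &&
                             ([set u; v] \in E))
    (chi u - chi v) *m (chi u - chi v)^T.
End Laplacian.

Definition psd (R : realType) (m : nat) (A : 'M[R]_m) : Prop :=
  A^T = A /\ forall x : 'cV[R]_m, 0 <= (x^T *m A *m x) 0 0.

Definition loewner_le (R : realType) (m : nat) (A B : 'M[R]_m) : Prop :=
  psd (B - A).

(* The minimum of k_1, ..., k_d.  Each k_h is less than n, so the default value
   n of the iterated minimum plays no role for 0 < d. *)
Definition k_min (n d : nat) (k : d.-tuple nat) : nat :=
  \big[minn/n]_(h < d) tnth k h.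

(* Structured programs for a unit-cost random access machine whose memory is
   a family of arrays of natural numbers.  The only arithmetic operations are
   addition and truncated subtraction, so one command lengthens numbers by
   O(1) bits and running times agree with those of Turing machines up to a
   polynomial.  An expression costs nothing by itself: its size is bounded by
   a constant of the program. *)

Inductive rexp : Type :=
| RConst of nat
| RGet of nat & rexp
| RAdd of rexp & rexp
| RSub of rexp & rexp.

Inductive rcmd : Type :=
| RSkip
| RPut of nat & rexp & rexp
| RSeq of rcmd & rcmd
| RIf of rexp & rcmd & rcmd
| RWhile of rexp & rcmd.

(* m a i is the content of cell i of array a. *)
Definition memory := nat -> nat -> nat.

Definition mem_set (m : memory) (a i x : nat) : memory :=
  fun b j => if (b == a) && (j == i) then x else m b j.

Fixpoint reval (m : memory) (e : rexp) : nat :=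
  match e with
  | RConst x => x
  | RGet a e1 => m a (reval m e1)
  | RAdd e1 e2 => (reval m e1 + reval m e2)%N
  | RSub e1 e2 => (reval m e1 - reval m e2)%N
  end.

(* rexec p m m' t: started in memory m, the program p halts in memory m' after
   t steps.  Tests succeed on nonzero values. *)
Inductive rexec : rcmd -> memory -> memory -> nat -> Prop :=
| exec_skip m : rexec RSkip m m 1
| exec_put a e1 e2 m :
    rexec (RPut a e1 e2) m (mem_set m a (reval m e1) (reval m e2)) 1
| exec_seq p1 p2 m m1 m2 t1 t2 :
    rexec p1 m m1 t1 -> rexec p2 m1 m2 t2 ->
    rexec (RSeq p1 p2) m m2 (t1 + t2).+1
| exec_if_true e p1 p2 m m' t :
    reval m e != 0%N -> rexec p1 m m' t -> rexec (RIf e p1 p2) m m' t.+1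
| exec_if_false e p1 p2 m m' t :
    reval m e = 0%N -> rexec p2 m m' t -> rexec (RIf e p1 p2) m m' t.+1
| exec_while_true e p m m1 m2 t1 t2 :
    reval m e != 0%N -> rexec p m m1 t1 -> rexec (RWhile e p) m1 m2 t2 ->
    rexec (RWhile e p) m m2 (t1 + t2).+1
| exec_while_false e p m :
    reval m e = 0%N -> rexec (RWhile e p) m m 1.

(* Input: n in array 0, d in array 1, k_1, ..., k_d in array 2; all other
   cells contain 0. *)
Definition input_memory (n d : nat) (k : d.-tuple nat) : memory :=
  fun a i => nth 0%N (nth [::] [:: [:: n]; [:: d]; val k] a) i.

(* Array a contains the adjacency matrix, in row-major order, of the graph with
   vertex set V and edge set E.  On a product of graphs, enum_rank numbers the
   vertices lexicographically (enum_rank_pair). *)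
Definition stores_edges (V : finType) (m : memory) (a : nat)
    (E : {set {set V}}) : Prop :=
  forall u v : V,
    m a (enum_rank u * #|V| + enum_rank v)%N = ([set u; v] \in E) :> nat.

Lemma enum_rank_pair (V W : finType) (u : V) (w : W) :
  enum_rank (u, w) = (enum_rank u * #|W| + enum_rank w)%N :> nat.
Proof.
have rankE (T : finType) (x : T) : enum_rank x = index x (enum T) :> nat.
  by rewrite -[in RHS](enum_rankK x) /enum_val index_uniq ?enum_uniq -?cardE.
rewrite !rankE.
have -> : enum ((V * W)%type : finType) = prod_enum V W.
  by rewrite enumT unlock.
rewrite /prod_enum; have: u \in enum V by rewrite mem_enum.
elim: (enum V) => //= x s IHs; rewrite inE index_cat.
have [<- _|neq_xu /= us] := eqVneq x u.
  rewrite map_f ?mem_enum // mul0n add0n index_map //.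
  by move=> w1 w2 [].
case: ifP => [/mapP[w' _ [eq_ux]]|_]; first by rewrite eq_ux eqxx in neq_xu.
by rewrite size_map -cardE IHs // mulSn addnA.
Qed.

(* On input n, d, k the program p writes the edge sets E1 and E2 to the arrays
   3 and 4 within T steps. *)
Definition computes_partition (p : rcmd) (n d : nat) (k : d.-tuple nat)
    (V : finType) (E1 E2 : {set {set V}}) (T : nat) : Prop :=
  exists m t, [/\ rexec p (input_memory n k) m t, (t <= T)%N,
                  stores_edges m 3 E1 & stores_edges m 4 E2].

(* Main.v *)
Require Import Defs.
From HB Require Import structures.
From mathcomp Require Import all_boot all_order all_algebra.
From mathcomp Require Import reals.
From mathcomp Require Import cyclic separable cyclotomic complex ring lra zify.

Set Implicit Arguments.
Unset Strict Implicit.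
Unset Printing Implicit Defensive.

Import Order.TTheory GRing.Theory Num.Theory.
Local Open Scope ring_scope.

(** An edge of either product moves one coordinate (Cartesian) or all of them
    (tensor), coordinate h by a circular distance between 1 and k_h.  Let
    distance j carry the (j-1)-st term of the Rudin-Shapiro sequence and let an
    edge carry the product of the signs of the distances by which it moves.
    The parts E1 and E2 are the edges of sign +1 and -1.  Signs depend only on
    differences of vertices, so the characters of Z_n^d diagonalize both
    Laplacians, and matrix inequalities become inequalities between
    eigenvalues (energy_le, diagonalized_cyclic).

    In one coordinate, with z an n-th root of unity and s_j the signs, the claim
    is that |sum_j s_j |1 - z^j|^2| is O(1/sqrt k) times sum_j |1 - z^j|^2, the
    sums being over j = 1, ..., k (signed_energy_bound).  The Rudin-Shapiro
    polynomials of length k are O(sqrt k) on the whole unit circle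
    (rs_poly_bound), hence so is the left side; if k |1 - z| is large, the right
    sum is at least k, which suffices.  If k |1 - z| is bounded, |1 - z^j|^2 is
    of order j^2 |1 - z|^2 for small j and varies slowly, and summation by parts
    against the partial sums of the s_j, which are O(sqrt k), gains the
    factor 1/sqrt k.

    For Cartesian products Laplacian eigenvalues add up, and so do the
    estimates.  For tensor products the degree D, the signed degree S, and the
    eigenvalues a and b of the adjacency and of the signed adjacency matrix all
    multiply, and |S - b| has to be bounded by a multiple of D - a.  The
    difference D - a is small not only if a is close to D in all coordinates: an
    even number of coordinates may have a close to -D.  The remedy is to
    carry the bounds for (a, b) and for (-a, -b) at the same time; the resulting
    condition tensor_est is stable under products (tensor_estM).  The second
    bound holds in one coordinate because for k > 1 the eigenvalue a stays away
    from -D (dcos_sum_ge), while for k = 1 both matrices coincide.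

    The partition is computed by comparing the base n digits of the numbers of
    two vertices.  Three quantities decide about a pair: how many digits differ,
    by how much their distances exceed the bounds k_h, and the product of the
    signs.  A pair is an edge iff there is no excess and the number of differing
    digits is 1 (Cartesian) or d (tensor), so that one program, parametrized by
    this number, serves both cases (main_run). *)

(** * The Rudin-Shapiro sequence and its polynomials *)

Fixpoint rudin_shapiro_rec (fuel j : nat) : bool :=
  if fuel is f.+1 then rudin_shapiro_rec f j./2 (+) (odd j && odd j./2) else false.

(** The parity of the number of possibly overlapping blocks 11 in the binary
    expansion; fuel j suffices because halving decreases j. *)
Definition rudin_shapiro (j : nat) : bool := rudin_shapiro_rec j j.

Lemma rudin_shapiro_rec_fuel f g j : (j <= f)%N -> (j <= g)%N ->
  rudin_shapiro_rec f j = rudin_shapiro_rec g j.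
Proof.
elim: f g j => [|f IHf] [|g] [|j] //= jf jg.
- by elim: g {jg} => //= g <-.
- by elim: f {IHf jf} => //= f ->.
- by congr (_ (+) _); apply: IHf.
- by congr (_ (+) _); apply: IHf; rewrite uphalf_half; lia.
Qed.

(** Removing the last binary digit destroys a block 11 exactly when the last
    two digits are 1. *)
Lemma rudin_shapiro_half j : rudin_shapiro j = rudin_shapiro j./2 (+) (odd j && odd j./2).
Proof.
case: j => // j; rewrite {1}/rudin_shapiro /=; congr (_ (+) _).
by apply: rudin_shapiro_rec_fuel; rewrite // uphalf_half; lia.
Qed.

Lemma rudin_shapiro_double j : rudin_shapiro j.*2 = rudin_shapiro j.
Proof. by rewrite rudin_shapiro_half odd_double doubleK addbF. Qed.

Lemma rudin_shapiro_doubleS j : rudin_shapiro j.*2.+1 = rudin_shapiro j (+) odd j.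
Proof. by rewrite rudin_shapiro_half /= odd_double /= uphalf_double. Qed.

Section Numbers.
Variable R : realType.
Local Notation C := R[i].
Local Notation modulus := (@Normc.normc R).

Definition rs_sign {T : pzRingType} (j : nat) : T := (-1) ^+ rudin_shapiro j.

Lemma modulus1 : modulus 1 = 1.
Proof. exact: Normc.normc1. Qed.

Lemma modulus0 : modulus 0 = 0.
Proof. exact: Normc.normc0. Qed.

Lemma modulusM x y : modulus (x * y) = modulus x * modulus y.
Proof. exact: Normc.normcM. Qed.

Lemma modulusD x y : modulus (x + y) <= modulus x + modulus y.
Proof. exact: le_normcD. Qed.

Lemma modulusX z m : modulus (z ^+ m) = modulus z ^+ m.
Proof.
elim: m => [|m IH]; first by rewrite !expr0 modulus1.
by rewrite !exprS modulusM IH.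
Qed.

Lemma modulusN z : modulus (- z) = modulus z.
Proof. exact: normcN. Qed.

Lemma modulus_ge0 z : 0 <= modulus z.
Proof. by case: z => a b; rewrite /= sqrtr_ge0. Qed.

Lemma modulus_signM j z : modulus (rs_sign j * z) = modulus z.
Proof. by rewrite /rs_sign; case: rudin_shapiro; rewrite ?expr1 ?mulN1r ?modulusN // mul1r. Qed.

Lemma parallelogram x y :
  modulus (x + y) ^+ 2 + modulus (x - y) ^+ 2 = 2 * (modulus x ^+ 2 + modulus y ^+ 2).
Proof.
case: x y => [a b] [c d] /=.
rewrite !sqr_sqrtr ?addr_ge0 ?sqr_ge0 //; ring.
Qed.

Definition rs_poly (N : nat) (z : C) : C := \sum_(j < N) rs_sign j * z ^+ j.

Lemma rs_polyS N z : rs_poly N.+1 z = rs_poly N z + rs_sign N * z ^+ N.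
Proof. by rewrite /rs_poly big_ord_recr. Qed.

(** Splitting into even and odd exponents; it is the sign flip of the odd terms
    that makes the parallelogram law applicable to the pair of values at z and
    at -z. *)
Lemma rs_poly_double N z : rs_poly N.*2 z = rs_poly N (z ^+ 2) + z * rs_poly N (- z ^+ 2).
Proof.
elim: N => [|N IH]; first by rewrite /rs_poly !big_ord0 mulr0 addr0.
rewrite doubleS !rs_polyS IH /rs_sign rudin_shapiro_double rudin_shapiro_doubleS.
rewrite [z ^+ N.*2.+1]exprS -[N.*2]mul2n exprM [(- _) ^+ N]exprNn.
rewrite signr_addb signr_odd. ring.
Qed.

Lemma rs_poly_doubleN N z : rs_poly N.*2 (- z) = rs_poly N (z ^+ 2) - z * rs_poly N (- z ^+ 2).
Proof. by rewrite rs_poly_double sqrrN mulNr. Qed.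

(** The values at z and -z form the Rudin-Shapiro pair: only the sum of their
    squared moduli obeys an exact recursion. *)
Definition rs_energy N z := modulus (rs_poly N z) ^+ 2 + modulus (rs_poly N (- z)) ^+ 2.

Lemma rs_energy_double N z : modulus z = 1 -> rs_energy N.*2 z = 2 * rs_energy N (z ^+ 2).
Proof.
move=> z1; rewrite /rs_energy rs_poly_double rs_poly_doubleN parallelogram.
by rewrite modulusM z1 mul1r.
Qed.

(** Induction on the binary expansion of N.  Doubling N doubles the energy, so
    that its square root grows like sqrt N; an odd N moreover adds a vector of
    length sqrt 2 to the Rudin-Shapiro pair.  The term -4 absorbs these
    additions: doubling scales it to -4 sqrt 2, and -4 sqrt 2 + sqrt 2 <= -4. *)
Lemma rs_energy_bound N z : (0 < N)%N -> modulus z = 1 ->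
  rs_energy N z <= (6 * Num.sqrt N%:R - 4) ^+ 2.
Proof.
elim/ltn_ind: N z => N IH z N0 z1.
have [N1|N1] := eqVneq N 1%N.
  rewrite N1 /rs_energy /rs_poly !big_ord1 !expr0 modulus_signM modulus1 sqrtr1.
  by lra.
have M0 : (0 < N./2)%N by case: N N0 N1 {IH} => [|[|N]].
have MN : (N./2 < N)%N by rewrite ltn_half_double -addnn; lia.
set M := N./2 in M0 MN.
have z2 : modulus (z ^+ 2) = 1 by rewrite modulusX z1 expr1n.
have := IH M MN (z ^+ 2) M0 z2.
set r := Num.sqrt M%:R => IHM.
have r2 : r ^+ 2 = M%:R by rewrite sqr_sqrtr ?ler0n.
have r0 : 0 <= r by rewrite sqrtr_ge0.
have r1 : 1 <= r by rewrite -(sqrtr1 R) ler_sqrt ?ltr0n // ler1n.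
have u0 : 0 <= Num.sqrt N%:R :> R by rewrite sqrtr_ge0.
have u2 : (Num.sqrt N%:R) ^+ 2 = N%:R :> R by rewrite sqr_sqrtr ?ler0n.
set u := Num.sqrt N%:R in u0 u2 *.
pose w : R := Num.sqrt 2.
have w0 : 0 <= w by rewrite sqrtr_ge0.
have w2 : w ^+ 2 = 2 by rewrite sqr_sqrtr ?ler0n.
have wl : 7 / 5 <= w by rewrite -[leLHS]ger0_norm -?sqrtr_sqr ?ler_sqrt //; lra.
have wru : w * r <= u.
  rewrite -(@ler_pXn2r _ 2) ?nnegrE ?mulr_ge0 // exprMn w2 r2 u2 -natrM ler_nat.
  by rewrite /M; lia.
have rse2 : rs_energy M.*2 z <= (w * (6 * r - 4)) ^+ 2.
  by rewrite rs_energy_double // exprMn w2 ler_pM2l.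
have p0 : 0 <= w * (6 * r - 4) by apply: mulr_ge0 => //; lra.
have mono t : 0 <= t -> t <= 6 * u - 4 -> t ^+ 2 <= (6 * u - 4) ^+ 2.
  by move=> t0 tu; rewrite ler_pXn2r ?nnegrE //; lra.
have [oN|eN] := boolP (odd N); last first.
  have -> : N = M.*2 by rewrite /M even_halfK.
  apply: (le_trans rse2); apply: mono => //.
  by nra.
have NE : N = M.*2.+1 by rewrite /M odd_halfK // prednK.
rewrite {1}NE /rs_energy !rs_polyS; set f := rs_poly _ _; set g := rs_poly _ (- z).
have fb : modulus (f + rs_sign M.*2 * z ^+ M.*2) <= modulus f + 1.
  by rewrite (le_trans (modulusD _ _)) // modulus_signM modulusX z1 expr1n.
have gb : modulus (g + rs_sign M.*2 * (- z) ^+ M.*2) <= modulus g + 1.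
  by rewrite (le_trans (modulusD _ _)) // modulus_signM modulusX modulusN z1 expr1n.
have fg : modulus f ^+ 2 + modulus g ^+ 2 <= (w * (6 * r - 4)) ^+ 2 by [].
move: (modulus_ge0 f) (modulus_ge0 g) (modulus_ge0 (f + rs_sign M.*2 * z ^+ M.*2))
  (modulus_ge0 (g + rs_sign M.*2 * (- z) ^+ M.*2)) fb gb fg.
set F := modulus f; set G := modulus g; set F' := modulus (f + _); set G' := modulus (g + _).
set p := 6 * r - 4 in p0 *.
move=> F0 G0 F'0 G'0 fb gb fg.
(* The two values increase by at most 1 each; their sum is controlled by
   the quadratic mean. *)
have FG : F + G <= 2 * p.
  have : (F + G) ^+ 2 <= (2 * p) ^+ 2.
    apply: (@le_trans _ _ (2 * (F ^+ 2 + G ^+ 2))).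
      by have := sqr_ge0 (F - G); lra.
    by move: fg; rewrite !exprMn w2; lra.
  by rewrite ler_pXn2r ?nnegrE //; rewrite ?addr_ge0 // /p; lra.
apply: (@le_trans _ _ ((F + 1) ^+ 2 + (G + 1) ^+ 2)).
  by apply: lerD; rewrite ler_pXn2r ?nnegrE //; lra.
apply: (@le_trans _ _ ((w * (p + 1)) ^+ 2)).
  by move: fg; rewrite !exprMn w2; lra.
apply: mono; first by rewrite mulr_ge0 // /p; lra.
by rewrite /p; nra.
Qed.

Lemma rs_poly_bound N z : modulus z = 1 -> modulus (rs_poly N z) <= 6 * Num.sqrt N%:R.
Proof.
move=> z1; case: N => [|N]; first by rewrite /rs_poly big_ord0 modulus0 sqrtr0 mulr0.
have := rs_energy_bound (ltn0Sn N) z1.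
have r1 : 1 <= Num.sqrt N.+1%:R :> R by rewrite -{1}(sqrtr1 R) ler_sqrt ?ltr0n ?ler1n.
rewrite /rs_energy => h; apply: (@le_trans _ _ (6 * Num.sqrt N.+1%:R - 4)); last by lra.
rewrite -(@ler_pXn2r _ 2) ?nnegrE ?modulus_ge0 //; last by lra.
by apply: le_trans h; rewrite lerDl sqr_ge0.
Qed.
End Numbers.

(** * Signed sums of squared chords on the unit circle *)

Section OneDim.
Variable R : realType.
Local Notation C := R[i].
Local Notation modulus := (@Normc.normc R).
Local Notation Re := (@complex.Re R).
Local Notation Im := (@complex.Im R).
Implicit Types z w : C.

Lemma ReD (x y : C) : Re (x + y) = Re x + Re y.
Proof. by case: x y => [a b] [c d]. Qed.

Lemma Re_signM j (x : C) : Re (rs_sign j * x) = rs_sign j * Re x.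
Proof.
by rewrite /rs_sign; case: rudin_shapiro; rewrite ?expr0 ?expr1 ?mul1r // !mulN1r; case: x.
Qed.

Lemma norm_Re_le (x : C) : `|Re x| <= modulus x.
Proof. by case: x => a b /=; rewrite -sqrtr_sqr ler_wsqrtr // lerDl sqr_ge0. Qed.

(** For z of modulus 1 and argument t this is 2 cos (j t), the contribution of
    the generators j and -j to an adjacency eigenvalue. *)
Definition dcos z (j : nat) : R := 2 * Re (z ^+ j).
Definition chord z (j : nat) : R := modulus (1 - z ^+ j).

Lemma modulus_sqrE (x : C) : modulus x ^+ 2 = Re x ^+ 2 + Im x ^+ 2.
Proof. by case: x => a b /=; rewrite sqr_sqrtr // addr_ge0 ?sqr_ge0. Qed.

Lemma dcosB z j : modulus z = 1 -> 2 - dcos z j = chord z j ^+ 2.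
Proof.
move=> z1; rewrite /dcos /chord; have := modulus_sqrE (z ^+ j).
rewrite modulusX z1 expr1n modulus_sqrE; case: (z ^+ j) => a b /=; rewrite expr1n.
by move=> h; rewrite sub0r sqrrN; nra.
Qed.

Lemma dcosD z j : modulus z = 1 -> 2 + dcos z j = modulus (1 + z ^+ j) ^+ 2.
Proof.
move=> z1; rewrite /dcos; have := modulus_sqrE (z ^+ j).
rewrite modulusX z1 expr1n modulus_sqrE; case: (z ^+ j) => a b /=; rewrite expr1n.
by move=> h; rewrite add0r; nra.
Qed.

Lemma dcos_double z j : modulus z = 1 -> dcos z j.*2 = dcos z j ^+ 2 - 2.
Proof.
move=> z1; rewrite /dcos; have := modulus_sqrE (z ^+ j).
rewrite modulusX z1 expr1n -muln2 exprM; case: (z ^+ j) => a b /=; rewrite expr1n.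
by move=> h; nra.
Qed.

Lemma signed_dcos_sum z k :
  \sum_(j < k) rs_sign j * dcos z j.+1 = 2 * Re (z * rs_poly k z).
Proof.
elim: k => [|k IH]; first by rewrite /rs_poly !big_ord0 mulr0 /= mulr0.
rewrite big_ord_recr /= IH rs_polyS mulrDr ReD.
by rewrite [z * (rs_sign _ * _)]mulrCA Re_signM /dcos exprS; ring.
Qed.

(** The signed sum is twice the real part of z times a Rudin-Shapiro polynomial. *)
Lemma signed_dcos_bound z k : modulus z = 1 ->
  `|\sum_(j < k) rs_sign j * dcos z j.+1| <= 12 * Num.sqrt k%:R.
Proof.
move=> z1; rewrite signed_dcos_sum normrM ger0_norm ?ler0n //.
have := norm_Re_le (z * rs_poly k z); rewrite modulusM z1 mul1r.
have := rs_poly_bound k z1; lra.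
Qed.

Lemma dcos1 j : dcos 1 j = 2.
Proof. by rewrite /dcos expr1n /= mulr1. Qed.

(** The special case z = 1. *)
Lemma rs_sign_sum_bound k : `|\sum_(j < k) (rs_sign j : R)| <= 6 * Num.sqrt k%:R.
Proof.
have := signed_dcos_bound k (modulus1 R).
have -> : \sum_(j < k) (rs_sign j : R) * dcos 1 j.+1 = (\sum_(j < k) rs_sign j) * 2.
  by rewrite mulr_suml; apply: eq_bigr => j _; rewrite dcos1.
by rewrite normrM [`|2|]ger0_norm ?ler0n //; lra.
Qed.

Section Chords.
Variables (z : C) (z1 : modulus z = 1).
Local Notation mu := (modulus (1 - z)).

Lemma chordS_le j : chord z j.+1 <= chord z j + mu.
Proof.
rewrite /chord; have -> : 1 - z ^+ j.+1 = (1 - z ^+ j) + z ^+ j * (1 - z).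
  by rewrite exprSr; ring.
by apply: le_trans (modulusD _ _) _; rewrite modulusM modulusX z1 expr1n mul1r.
Qed.

Lemma chord_leS j : chord z j <= chord z j.+1 + mu.
Proof.
rewrite /chord; have -> : 1 - z ^+ j = (1 - z ^+ j.+1) - z ^+ j * (1 - z).
  by rewrite exprSr; ring.
by apply: le_trans (modulusD _ _) _; rewrite modulusN modulusM modulusX z1 expr1n mul1r.
Qed.

Lemma chord_ge0 j : 0 <= chord z j. Proof. exact: modulus_ge0. Qed.

Lemma chord_le j : chord z j <= j%:R * mu.
Proof.
elim: j => [|j IH]; first by rewrite /chord expr0 subrr modulus0 mul0r.
by have := chordS_le j; rewrite -natr1; lra.
Qed.

(** Both chords are at most (j + 1) |1 - z| and they differ by at most |1 - z|. *)
Lemma chord_sqr_var j :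
  `|chord z j.+1 ^+ 2 - chord z j ^+ 2| <= (2 * j%:R + 1) * mu ^+ 2.
Proof.
have := (chordS_le j, chord_leS j, chord_ge0 j, chord_ge0 j.+1).
have := (chord_le j, chord_le j.+1, modulus_ge0 (1 - z)); rewrite -natr1.
set m := modulus _; set a := chord z j; set b := chord z j.+1; set x := j%:R.
move=> [[ax bx] m0] [[[ba ab] a0] b0].
rewrite subr_sqr normrM; apply: (@le_trans _ _ (m * ((2 * x + 1) * m))); last first.
  by rewrite expr2; nra.
apply: ler_pM => //; first by rewrite ler_norml; lra.
rewrite ger0_norm; lra.
Qed.

Definition chord_energy k : R := \sum_(j < k) chord z j.+1 ^+ 2.

Lemma chord_energy_ge0 k : 0 <= chord_energy k.
Proof. by apply: sumr_ge0 => j _; rewrite sqr_ge0. Qed.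

Lemma chord_energy_mono k l : (k <= l)%N -> chord_energy k <= chord_energy l.
Proof.
move=> kl; rewrite /chord_energy -(big_mkord xpredT (fun j => chord z j.+1 ^+ 2)).
rewrite -(big_mkord xpredT (fun j => chord z j.+1 ^+ 2)).
rewrite (big_cat_nat (leq0n _) kl) //= lerDl; apply: sumr_ge0 => j _; exact: sqr_ge0.
Qed.

(** Summation by parts; no boundary term appears at 0 because the chord of
    exponent 0 vanishes. *)
Lemma signed_energy_parts k :
  \sum_(j < k) rs_sign j * chord z j.+1 ^+ 2 =
  chord z k ^+ 2 * (\sum_(j < k) rs_sign j)
  - \sum_(i < k) (chord z i.+1 ^+ 2 - chord z i ^+ 2) * (\sum_(j < i) rs_sign j).
Proof.
elim: k => [|k IH]; first by rewrite !big_ord0 mulr0 subr0.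
by rewrite !big_ord_recr /= IH; ring.
Qed.

(** The partial sums of the signs are O(sqrt k), and the squared chords have
    total variation at most k^2 |1 - z|^2. *)
Lemma signed_energy_small k :
  `|\sum_(j < k) rs_sign j * chord z j.+1 ^+ 2|
    <= 12 * Num.sqrt k%:R * (k%:R ^+ 2 * mu ^+ 2).
Proof.
pose s : R := 6 * Num.sqrt k%:R.
have s0 : 0 <= s by rewrite mulr_ge0 ?sqrtr_ge0.
have sb i : (i <= k)%N -> `|\sum_(j < i) (rs_sign j : R)| <= s.
  move=> ik; apply: le_trans (rs_sign_sum_bound i) _.
  by rewrite ler_pM2l // ler_wsqrtr // ler_nat.
have var m : (m <= k)%N ->
    `|\sum_(i < m) (chord z i.+1 ^+ 2 - chord z i ^+ 2) * (\sum_(j < i) rs_sign j)|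
      <= m%:R ^+ 2 * mu ^+ 2 * s.
  elim: m => [_|m IH mk]; first by rewrite big_ord0 normr0 expr0n /= !mul0r.
  rewrite big_ord_recr /=; apply: le_trans (ler_normD _ _) _.
  have -> : m.+1%:R ^+ 2 * mu ^+ 2 * s =
    m%:R ^+ 2 * mu ^+ 2 * s + (2 * m%:R + 1) * mu ^+ 2 * s.
    by rewrite -natr1; ring.
  apply: lerD; first exact: IH (ltnW mk).
  by rewrite normrM; apply: ler_pM => //; [exact: chord_sqr_var | exact: sb (ltnW mk)].
rewrite signed_energy_parts; apply: le_trans (ler_normB _ _) _.
have -> : 12 * Num.sqrt k%:R * (k%:R ^+ 2 * mu ^+ 2) =
   k%:R ^+ 2 * mu ^+ 2 * s + k%:R ^+ 2 * mu ^+ 2 * s.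
  by rewrite /s; ring.
apply: lerD; last exact: var.
rewrite normrM; apply: ler_pM => //; last exact: sb.
rewrite ger0_norm ?sqr_ge0 // -exprMn.
by rewrite ler_pXn2r ?nnegrE ?chord_ge0 ?mulr_ge0 ?ler0n ?modulus_ge0 ?chord_le.
Qed.

(** The chord of exponent j is j (1 - z) up to a quadratic error. *)
Lemma chord_linear j :
  modulus ((1 - z ^+ j) - j%:R * (1 - z)) <= j%:R ^+ 2 * mu ^+ 2 / 2.
Proof.
elim: j => [|j IH]; first by rewrite expr0 subrr mul0r subr0 modulus0 expr0n /= !mul0r.
have -> : 1 - z ^+ j.+1 - j.+1%:R * (1 - z) =
  (1 - z ^+ j - j%:R * (1 - z)) - (1 - z ^+ j) * (1 - z).
  by rewrite exprSr -natr1; ring.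
apply: le_trans (modulusD _ _) _; rewrite modulusN modulusM.
have : chord z j * mu <= j%:R * mu * mu by rewrite ler_wpM2r ?modulus_ge0 ?chord_le.
have := sqr_ge0 mu; move: IH; rewrite /chord -[j.+1%:R]natr1; lra.
Qed.

Lemma modulus_natr (j : nat) : modulus j%:R = j%:R.
Proof.
rewrite -(rmorph_nat (real_complex R)) /= expr0n /= addr0.
by rewrite sqrtr_sqr ger0_norm.
Qed.

Lemma chord_ge j : j%:R * mu <= 1 -> j%:R * mu / 2 <= chord z j.
Proof.
move=> j1; have jm0 : 0 <= j%:R * mu by rewrite mulr_ge0 ?modulus_ge0.
have h1 : modulus (j%:R * (1 - z)) <=
    chord z j + modulus ((1 - z ^+ j) - j%:R * (1 - z)).
  rewrite -[modulus (_ - j%:R * _)]modulusN opprB.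
  have -> : modulus (j%:R * (1 - z)) =
    modulus ((1 - z ^+ j) + (j%:R * (1 - z) - (1 - z ^+ j))) by congr modulus; ring.
  exact: modulusD.
have := chord_linear j; rewrite modulusM modulus_natr in h1; rewrite -exprMn => h2.
have : (j%:R * mu) ^+ 2 <= j%:R * mu by rewrite expr2 ler_piMl.
lra.
Qed.

(** Below the threshold j |1 - z| <= 1 each chord is at least j |1 - z| / 2. *)
Lemma chord_energy_ge_cube k : k%:R * mu <= 1 -> k%:R ^+ 3 * mu ^+ 2 / 12 <= chord_energy k.
Proof.
elim: k => [|k IH] km; first by rewrite expr0n /= !mul0r chord_energy_ge0.
have km' : k%:R * mu <= 1.
  by apply: le_trans km; rewrite ler_wpM2r ?modulus_ge0 ?ler_nat.
rewrite /chord_energy big_ord_recr /= -/(chord_energy k).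
have h : (k.+1%:R * mu / 2) ^+ 2 <= chord z k.+1 ^+ 2.
  rewrite ler_pXn2r ?nnegrE ?chord_ge0 ?chord_ge //.
  by rewrite !mulr_ge0 ?modulus_ge0 ?invr_ge0.
have := IH km'; move: h; rewrite -natr1.
have k0 : 0 <= k%:R :> R by [].
have := mulr_ge0 k0 (sqr_ge0 mu); have := sqr_ge0 mu.
lra.
Qed.

Lemma chord_energyE k : chord_energy k = 2 * k%:R - 2 * Re (\sum_(j < k) z ^+ j.+1).
Proof.
elim: k => [|k IH]; first by rewrite /chord_energy !big_ord0 /= !mulr0 subr0.
rewrite /chord_energy !big_ord_recr /= -/(chord_energy k) IH ReD -dcosB // /dcos -natr1; ring.
Qed.

(** The sum of the powers of z is geometric, hence at most 2 / |1 - z|. *)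
Lemma chord_energy_large k : 4 <= k%:R * mu -> k%:R <= chord_energy k.
Proof.
move=> km; rewrite chord_energyE; set g := \sum_(j < k) _.
have gE : (1 - z) * g = z - z ^+ k.+1.
  rewrite /g; elim: k {km g} => [|k IH]; first by rewrite big_ord0 mulr0 expr1 subrr.
  by rewrite big_ord_recr /= mulrDr IH !exprS; ring.
have gb : mu * modulus g <= 2.
  rewrite -modulusM gE; apply: le_trans (modulusD _ _) _.
  by rewrite modulusN modulusX z1 expr1n -[leRHS]/(1 + 1).
have k0 : 0 <= k%:R :> R by [].
have mu0 : 0 < mu.
  rewrite lt0r modulus_ge0 andbT; apply: contraTneq km => ->.
  by rewrite mulr0 -ltNge.
have : modulus g <= k%:R / 2.
  by rewrite -(ler_pM2l mu0); apply: le_trans gb _; lra.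
have := norm_Re_le g; rewrite ler_norml => /andP[_]; lra.
Qed.

Lemma signed_energyE k : \sum_(j < k) rs_sign j * chord z j.+1 ^+ 2 =
  2 * (\sum_(j < k) rs_sign j) - \sum_(j < k) rs_sign j * dcos z j.+1.
Proof.
rewrite mulr_sumr -sumrB; apply: eq_bigr => j _.
by rewrite -dcosB //; ring.
Qed.

(** The heart of the matter in one dimension.  The three regimes are: k < 4,
    where the triangle inequality suffices; k |1 - z| >= 4, where the chord
    energy is of order k and the Rudin-Shapiro bound is applied directly; and the
    remaining case, where both sides are compared with k^3 |1 - z|^2. *)
Lemma signed_energy_bound k :
  Num.sqrt k%:R * `|\sum_(j < k) rs_sign j * chord z j.+1 ^+ 2| <= 72 * 1024 * chord_energy k.
Proof.
have r0 : 0 <= Num.sqrt k%:R :> R by rewrite sqrtr_ge0.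
have r2 : Num.sqrt k%:R ^+ 2 = k%:R :> R by rewrite sqr_sqrtr.
have L0 := chord_energy_ge0 k.
have mu0 := modulus_ge0 (1 - z).
have [k4|k4] := ltnP k 4.
  have h1 : `|\sum_(j < k) rs_sign j * chord z j.+1 ^+ 2| <= chord_energy k.
    apply: le_trans (ler_norm_sum _ _ _) _; apply: ler_sum => j _.
    rewrite normrM /rs_sign normr_sign mul1r ger0_norm ?sqr_ge0 //.
  have h2 : Num.sqrt k%:R <= 2 :> R.
    rewrite -(@ler_pXn2r _ 2) ?nnegrE // r2 -natrX ler_nat; lia.
  by apply: le_trans (ler_pM r0 (normr_ge0 _) h2 h1) _; lra.
have [km|km] := leP 4 (k%:R * mu).
  have := chord_energy_large km => kL.
  have h : `|\sum_(j < k) rs_sign j * chord z j.+1 ^+ 2| <= 24 * Num.sqrt k%:R.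
    rewrite signed_energyE; apply: le_trans (ler_normB _ _) _.
    have := rs_sign_sum_bound k; have := signed_dcos_bound k z1.
    by rewrite normrM [`|2|]ger0_norm //; lra.
  apply: le_trans (ler_wpM2l r0 h) _; rewrite mulrCA -expr2 r2; lra.
have h := signed_energy_small k.
apply: le_trans (ler_wpM2l r0 h) _.
(* l |1 - z| <= 1 brings the exponents up to l below the threshold of the
   cubic lower bound, and k <= 8 l since k >= 4. *)
pose l := (k %/ 4)%N.
have lk : (4 * l <= k)%N by rewrite /l; lia.
have kl : (k <= 8 * l)%N by rewrite /l; lia.
have lm : l%:R * mu <= 1.
  have : 4 * l%:R <= k%:R :> R by rewrite -natrM ler_nat.
  move=> h4; have := ler_wpM2r mu0 h4; lra.
have := chord_energy_ge_cube lm; have := @chord_energy_mono l k ltac:(lia).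
have : k%:R ^+ 3 <= (8 * l%:R) ^+ 3 :> R.
  by rewrite -natrM ler_pXn2r ?nnegrE // ler_nat.
move=> h3; have := ler_wpM2r (sqr_ge0 mu) h3; rewrite exprMn.
have -> : Num.sqrt k%:R * (12 * Num.sqrt k%:R * (k%:R ^+ 2 * mu ^+ 2)) =
  12 * (k%:R ^+ 3 * mu ^+ 2).
  by transitivity (12 * (Num.sqrt k%:R ^+ 2 * (k%:R ^+ 2 * mu ^+ 2))); [ring | rewrite r2; ring].
lra.
Qed.

Lemma dcosD_ge0 j : 0 <= 2 + dcos z j.
Proof. by rewrite dcosD // sqr_ge0. Qed.

(** With x = 2 cos t one has (2 + x) + (2 + (x^2 - 2)) >= 7/4, so the exponents j
    and 2 j cannot both be close to -2.  Each exponent up to k occurs at most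
    twice in the pairs (j, 2 j) with 2 j <= k. *)
Lemma dcos_sum_ge k : (1 < k)%N -> 7 / 24 * k%:R <= \sum_(j < k) (2 + dcos z j.+1).
Proof.
move=> k1.
have dbl m : \sum_(j < m) (2 + dcos z j.+1.*2) <= \sum_(j < m.*2) (2 + dcos z j.+1).
  elim: m => [|m IH]; first by rewrite !big_ord0.
  rewrite doubleS !big_ord_recr /= -addrA; apply: lerD => //.
  by rewrite doubleS lerDr dcosD_ge0.
have sub m l : (m <= l)%N ->
    \sum_(j < m) (2 + dcos z j.+1) <= \sum_(j < l) (2 + dcos z j.+1).
  move=> kl; rewrite -(big_mkord xpredT (fun j => 2 + dcos z j.+1)).
  rewrite -(big_mkord xpredT (fun j => 2 + dcos z j.+1)).
  rewrite (big_cat_nat (leq0n _) kl) //= lerDl; apply: sumr_ge0 => j _; exact: dcosD_ge0.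
have pair j : 7 / 4 <= (2 + dcos z j) + (2 + dcos z j.*2).
  by rewrite dcos_double //; have := sqr_ge0 (dcos z j + 1 / 2); lra.
have : \sum_(j < k./2) (7 / 4) <= \sum_(j < k./2) ((2 + dcos z j.+1) + (2 + dcos z j.+1.*2)).
  by apply: ler_sum => j _; exact: pair.
rewrite big_split /= sumr_const card_ord -mulr_natr.
have := dbl k./2; have := @sub k./2 k ltac:(lia); have := @sub k./2.*2 k ltac:(lia).
have : k%:R <= 3 * k./2%:R :> R by rewrite -natrM ler_nat; lia.
lra.
Qed.

End Chords.
End OneDim.

(** * Eigenvalue estimates and their stability under products *)

Section Estimates.
Variable R : realType.
Local Notation C := R[i].
Local Notation modulus := (@Normc.normc R).

(** This is 12 * 12 * 8^3, the factors coming from signed_energy_small, from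
    chord_energy_ge_cube and from the loss of rounding k down to a multiple of 4.
    It is written as a product because numerals in a ring are unary. *)
Definition abs_const : R := 72 * 1024.

(** Here D and S are the degree and the signed degree, a and b eigenvalues of
    the adjacency and the signed adjacency matrix for the same eigenvector. *)
Definition cart_est (eps D S a b : R) : Prop := `|S - b| <= eps * (D - a).

Lemma cart_estD eps D D' S S' a a' b b' :
  cart_est eps D S a b -> cart_est eps D' S' a' b' ->
  cart_est eps (D + D') (S + S') (a + a') (b + b').
Proof.
rewrite /cart_est => h h'; rewrite opprD addrACA [in leRHS]opprD [in leRHS]addrACA mulrDr.
exact: le_trans (ler_normD _ _) (lerD h h').
Qed.

(** The last two conditions are exchanged by (a, b) -> (-a, -b); both are needed
    for stability under products, where two negative eigenvalues a multiply to a
    positive one.  The factors 1/2 make the bounds multiply without loss. *)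
Definition tensor_est (q D S a b : R) : Prop :=
  [/\ 0 < D /\ `|a| <= D, `|S| <= q / 2, `|b| <= q / 2,
      `|S - b| * D <= q * (D - a) & `|S + b| * D <= q * (D + a)].

(** By the symmetry (a, b) -> (-a, -b) in both factors one may take a >= 0.  If a'
    is negative, then a a' <= 0 and the triangle inequality is enough.  Otherwise S S' - b b' is split as S (S' - b') + b' (S - b), and D - a
    and D' - a' are compared with D D' - a a'. *)
Lemma tensor_est_half q q' D D' S S' a a' b b' :
  tensor_est q D S a b -> tensor_est q' D' S' a' b' ->
  `|S * S' - b * b'| * (D * D') <= q * q' * (D * D' - a * a').
Proof.
suff wlg b1 b1' a1 a1' : 0 <= a1 -> tensor_est q D S a1 b1 ->
    tensor_est q' D' S' a1' b1' ->
    `|S * S' - b1 * b1'| * (D * D') <= q * q' * (D * D' - a1 * a1').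
  move=> E E'; have [a0|a0] := leP 0 a; first exact: wlg E E'.
  rewrite -(mulrNN b) -(mulrNN a); apply: wlg.
  - by rewrite oppr_ge0 ltW.
  - by case: E => *; split; rewrite ?normrN ?opprK.
  - by case: E' => *; split; rewrite ?normrN ?opprK.
move=> a0 [[D0 aD] Sq bq d s] [[D'0 aD'] Sq' bq' d' s'].
have q0 : 0 <= q by have := normr_ge0 S; lra.
have q'0 : 0 <= q' by have := normr_ge0 S'; lra.
have [a'0|a'0] := leP 0 a1'; last first.
  have h : `|S * S' - b1 * b1'| <= q * q' / 2.
    apply: le_trans (ler_normB _ _) _; rewrite !normrM.
    have := ler_pM (normr_ge0 _) (normr_ge0 _) Sq Sq'.
    have := ler_pM (normr_ge0 _) (normr_ge0 _) bq bq'; lra.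
  have DD : 0 < D * D' by rewrite mulr_gt0.
  apply: le_trans (ler_wpM2r (ltW DD) h) _.
  have aa : a1 * a1' <= 0 by rewrite mulr_ge0_le0 // ltW.
  have qq : 0 <= q * q' by rewrite mulr_ge0.
  have := mulr_ge0 qq (ltW DD).
  have : q * q' * (a1 * a1') <= 0 by rewrite mulr_ge0_le0.
  lra.
have [aD1 aD1'] : a1 <= D /\ a1' <= D'.
  by move: aD aD'; rewrite !ger0_norm.
have -> : S * S' - b1 * b1' = S * (S' - b1') + b1' * (S - b1) by ring.
have h : `|S * (S' - b1') + b1' * (S - b1)| <=
    q / 2 * `|S' - b1'| + q' / 2 * `|S - b1|.
  apply: le_trans (ler_normD _ _) _; rewrite !normrM.
  by apply: lerD; apply: ler_wpM2r.
apply: le_trans (ler_wpM2r _ h) _; first by rewrite ltW ?mulr_gt0.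
have h1 : q / 2 * `|S' - b1'| * (D * D') <= q / 2 * D * (q' * (D' - a1')).
  have := ler_wpM2l (_ : 0 <= q / 2 * D) d'.
  by move=> /(_ (mulr_ge0 (divr_ge0 q0 (ler0n _ 2)) (ltW D0))); lra.
have h2 : q' / 2 * `|S - b1| * (D * D') <= q' / 2 * D' * (q * (D - a1)).
  have := ler_wpM2l (_ : 0 <= q' / 2 * D') d.
  by move=> /(_ (mulr_ge0 (divr_ge0 q'0 (ler0n _ 2)) (ltW D'0))); lra.
have qq : 0 <= q * q' by rewrite mulr_ge0.
have e1 : a1 * a1' <= D * a1' by rewrite ler_wpM2r.
have e2 : a1 * a1' <= a1 * D' by rewrite ler_wpM2l.
have := ler_wpM2l qq e1; have := ler_wpM2l qq e2.
lra.
Qed.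

(** The condition with opposite signs follows from the first one applied to
    (-a', -b'). *)
Lemma tensor_estM q q' D D' S S' a a' b b' :
  tensor_est q D S a b -> tensor_est q' D' S' a' b' ->
  tensor_est (q * q') (D * D') (S * S') (a * a') (b * b').
Proof.
move=> E E'; have := tensor_est_half E E'.
have E'N : tensor_est q' D' S' (- a') (- b').
  by case: E' => *; split; rewrite ?normrN ?opprK.
have := tensor_est_half E E'N; rewrite !mulrN !opprK.
case: E E' {E'N} => [[D0 aD] Sq bq _ _] [[D'0 aD'] Sq' bq' _ _] hp hm.
have q0 : 0 <= q by have := normr_ge0 S; lra.
have q'0 : 0 <= q' by have := normr_ge0 S'; lra.
have qq : 0 <= q * q' by rewrite mulr_ge0.
split=> //; first by rewrite mulr_gt0 // normrM ler_pM.
  by rewrite normrM; have := ler_pM (normr_ge0 _) (normr_ge0 _) Sq Sq'; lra.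
by rewrite normrM; have := ler_pM (normr_ge0 _) (normr_ge0 _) bq bq'; lra.
Qed.

Section Circle.
Variables (z : C) (z1 : modulus z = 1) (k : nat) (k0 : (0 < k)%N).
Local Notation D := (2 * k%:R : R).
Local Notation S := (2 * \sum_(j < k) rs_sign j : R).
Local Notation a := (\sum_(j < k) dcos z j.+1).
Local Notation b := (\sum_(j < k) rs_sign j * dcos z j.+1).

Lemma chord_energy_dcos : chord_energy z k = D - a.
Proof.
have -> : D = \sum_(j < k) 2 by rewrite sumr_const card_ord mulr_natr.
rewrite -sumrB.
by apply: eq_bigr => j _; rewrite dcosB.
Qed.

Lemma cart_est_circle : Num.sqrt k%:R * `|S - b| <= abs_const * (D - a).
Proof. by rewrite -signed_energyE // -chord_energy_dcos; exact: signed_energy_bound. Qed.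

(** For k = 1 the signed and the plain adjacency matrix coincide, which gives
    the last condition although D + a may vanish; for k > 1 the number D + a is
    of order k. *)
Lemma tensor_est_circle : tensor_est (abs_const * (2 * Num.sqrt k%:R)) D S a b.
Proof.
have r1 : 1 <= Num.sqrt k%:R :> R.
  by rewrite -{1}(sqrtr1 R) ler_sqrt ?ltr0n ?ler1n.
have r2 : Num.sqrt k%:R ^+ 2 = k%:R :> R by rewrite sqr_sqrtr.
have Sb := rs_sign_sum_bound R k; have bb := signed_dcos_bound k z1.
have k1 : 1 <= k%:R :> R by rewrite ler1n.
have la : 0 <= D - a by rewrite -chord_energy_dcos chord_energy_ge0.
have sa : D + a = \sum_(j < k) (2 + dcos z j.+1).
  by rewrite big_split /= sumr_const card_ord mulr_natr.
have ca : 0 <= D + a by rewrite sa; apply: sumr_ge0 => j _; exact: dcosD_ge0.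
have est := cart_est_circle.
have nS : `|S| = 2 * `|\sum_(j < k) (rs_sign j : R)|.
  by rewrite normrM [`|2|]ger0_norm.
split.
- by split; [lra | rewrite ler_norml; lra].
- by rewrite nS /abs_const; lra.
- by rewrite /abs_const; lra.
- have -> : abs_const * (2 * Num.sqrt k%:R) * (D - a) =
     2 * Num.sqrt k%:R * (abs_const * (D - a)) by ring.
  apply: le_trans (ler_wpM2l _ est); last by lra.
  have e1 x : x * D = 2 * Num.sqrt k%:R ^+ 2 * x by rewrite r2; ring.
  by rewrite e1 expr2 -!mulrA.
have [k2|k2] := ltnP 1 k; last first.
  have kE : k = 1%N by lia.
  move: ca; rewrite kE !big_ord1 /rs_sign sqrtr1 expr0 mul1r => ca.
  by rewrite /abs_const ger0_norm; lra.
have := dcos_sum_ge z1 k2; rewrite -sa => cl.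
have h : `|S + b| <= 24 * Num.sqrt k%:R.
  by apply: le_trans (ler_normD _ _) _; lra.
have h2 := ler_wpM2r (_ : 0 <= D) h.
apply: le_trans (h2 _) _; first by lra.
have h3 := ler_wpM2l (_ : 0 <= Num.sqrt k%:R) cl.
have := h3 ltac:(lra); rewrite /abs_const.
have : 0 <= Num.sqrt k%:R * k%:R :> R by apply: mulr_ge0; lra.
lra.
Qed.
End Circle.
End Estimates.

(** * Joint diagonalization of an adjacency matrix and a signing *)

Section Spectral.
Variable R : realType.
Local Notation C := R[i].
Local Notation modulus := (@Normc.normc R).
Local Notation toC := (real_complex R).

Lemma toC_conj (x : R) : (toC x)^* = toC x.
Proof. by apply: conj_Creal; apply/complex_realP; exists x. Qed.

Lemma modulus_sqr (z : C) : z * z^* = toC (modulus z ^+ 2).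
Proof. by rewrite -normCK rmorphXn. Qed.

Section OneSpace.
Variables (V I : finType) (phi : I -> V -> C).

(** An orthogonal basis, as a resolution of the identity; the scaling by #|V|
    avoids square roots in the characters. *)
Definition complete : Prop :=
  forall u v, \sum_i phi i u * (phi i v)^* = #|V|%:R * (u == v)%:R.

(** The eigenvectors are complex, the eigenvalues real. *)
Definition eigen (W : V -> V -> R) (b : I -> R) : Prop :=
  forall i u, \sum_v toC (W u v) * phi i v = toC (b i) * phi i u.

Definition id_kernel (u v : V) : R := (u == v)%:R.

Lemma eigen_id : eigen id_kernel (fun=> 1).
Proof.
move=> i u; rewrite (bigD1 u) //= /id_kernel eqxx big1 ?addr0 // => v.
by rewrite eq_sym => /negPf->; rewrite rmorph0 mul0r.
Qed.

Lemma eigenD W W' b b' : eigen W b -> eigen W' b' ->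
  eigen (fun u v => W u v + W' u v) (fun i => b i + b' i).
Proof.
move=> E E' i u; rewrite rmorphD mulrDl -E -E' -big_split /=.
by apply: eq_bigr => v _; rewrite rmorphD mulrDl.
Qed.

Variable f : V -> R.
Definition fourier i : C := \sum_v (phi i v)^* * toC (f v).

Lemma fourier_conj i : (fourier i)^* = \sum_v phi i v * toC (f v).
Proof.
by rewrite /fourier rmorph_sum; apply: eq_bigr => v _; rewrite rmorphM /= conjCK toC_conj.
Qed.

Lemma fourier_inv (phiC : complete) u :
  \sum_i phi i u * fourier i = #|V|%:R * toC (f u).
Proof.
under eq_bigr => i _ do rewrite mulr_sumr.
rewrite exchange_big /= (bigD1 u) //= [X in _ + X]big1 ?addr0.
  under eq_bigr => i _ do rewrite mulrA.
  by rewrite -mulr_suml phiC eqxx mulr1.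
move=> v vu; under eq_bigr => i _ do rewrite mulrA.
by rewrite -mulr_suml phiC eq_sym (negPf vu) mulr0 mul0r.
Qed.

(** Parseval's identity for the form given by W; W = id_kernel is the
    usual one. *)
Lemma fourier_form (phiC : complete) W b : eigen W b ->
  \sum_i b i * modulus (fourier i) ^+ 2 =
  #|V|%:R * \sum_u \sum_v W u v * (f u * f v).
Proof.
move=> E; apply: (@complexI R); rewrite rmorphM rmorph_nat !rmorph_sum /=.
transitivity (\sum_u toC (f u) * \sum_v toC (W u v) * \sum_i phi i v * fourier i).
  under eq_bigr => i _ do rewrite rmorphM /= -modulus_sqr fourier_conj.
  have e i : toC (b i) * (fourier i * \sum_v phi i v * toC (f v)) =
      \sum_u toC (f u) * \sum_v toC (W u v) * (phi i v * fourier i).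
    rewrite mulrCA mulr_sumr mulr_sumr; apply: eq_bigr => u _.
    have -> : \sum_v toC (W u v) * (phi i v * fourier i) =
       (\sum_v toC (W u v) * phi i v) * fourier i.
      by rewrite mulr_suml; apply: eq_bigr => v _; rewrite mulrA.
    by rewrite E; ring.
  rewrite (eq_bigr _ (fun i _ => e i)) exchange_big /=; apply: eq_bigr => u _.
  rewrite -mulr_sumr; congr (_ * _); rewrite exchange_big /=.
  by apply: eq_bigr => v _; rewrite mulr_sumr.
rewrite mulr_sumr; apply: eq_bigr => u _; rewrite rmorph_sum !mulr_sumr /=.
by apply: eq_bigr => v _; rewrite fourier_inv // !rmorphM /=; ring.
Qed.

(** A regular weighted graph has Laplacian S - W, with eigenvalues S - b. *)
Lemma energy_fourier (phiC : complete) W b S : eigen W b ->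
    (forall u v, W u v = W v u) -> (forall u, \sum_v W u v = S) ->
  #|V|%:R * \sum_u \sum_v W u v * (f u - f v) ^+ 2 =
  2 * \sum_i (S - b i) * modulus (fourier i) ^+ 2.
Proof.
move=> E Wsym Wsum.
have -> : \sum_u \sum_v W u v * (f u - f v) ^+ 2 =
   2 * (S * \sum_u f u ^+ 2 - \sum_u \sum_v W u v * (f u * f v)).
  have e1 : \sum_u \sum_v W u v * f u ^+ 2 = S * \sum_u f u ^+ 2.
    by rewrite mulr_sumr; apply: eq_bigr => u _; rewrite -mulr_suml Wsum.
  have e2 : \sum_u \sum_v W u v * f v ^+ 2 = S * \sum_u f u ^+ 2.
    rewrite exchange_big /= -e1; apply: eq_bigr => u _.
    by apply: eq_bigr => v _; rewrite Wsym.
  transitivity (\sum_u \sum_v W u v * f u ^+ 2 + \sum_u \sum_v W u v * f v ^+ 2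
     - \sum_u \sum_v 2 * (W u v * (f u * f v))).
    rewrite -big_split -sumrB /=; apply: eq_bigr => u _.
    by rewrite -big_split -sumrB /=; apply: eq_bigr => v _; ring.
  rewrite e1 e2.
  under [X in _ - X]eq_bigr => u _ do rewrite -mulr_sumr.
  rewrite -mulr_sumr; ring.
have h1 : \sum_i 1 * modulus (fourier i) ^+ 2 = #|V|%:R * \sum_u f u ^+ 2.
  rewrite (fourier_form phiC eigen_id); congr (_ * _); apply: eq_bigr => u _.
  rewrite (bigD1 u) //= /id_kernel eqxx big1 ?addr0 ?mul1r // => v.
  by rewrite eq_sym => /negPf->; rewrite mul0r.
have h2 := fourier_form phiC E.
have -> : \sum_i (S - b i) * modulus (fourier i) ^+ 2 =
    S * (\sum_i 1 * modulus (fourier i) ^+ 2) - \sum_i b i * modulus (fourier i) ^+ 2.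
  by rewrite mulr_sumr -sumrB; apply: eq_bigr => i _; ring.
by rewrite h1 h2; ring.
Qed.
End OneSpace.

(** The eigenvalue pairs of the adjacency weights A and of the signed weights W
    for a common eigenbasis satisfy P; D and S are the row sums. *)
Definition diagonalized (V : finType) (A W : V -> V -> R) (D S : R)
    (P : R -> R -> Prop) : Prop :=
  [/\ forall u v, A u v = A v u, forall u v, W u v = W v u,
      forall u, \sum_v A u v = D, forall u, \sum_v W u v = S &
      exists (I : finType) (phi : I -> V -> C) (a b : I -> R),
        [/\ complete phi, eigen phi A a, eigen phi W b & forall i, P (a i) (b i)]].

(** An inequality between quadratic forms with a common eigenbasis reduces to
    the eigenvalues. *)
Lemma energy_le (V : finType) (A W : V -> V -> R) D S eps (f : V -> R) :
  diagonalized A W D S (cart_est eps D S) ->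
  `|\sum_u \sum_v W u v * (f u - f v) ^+ 2| <=
    eps * \sum_u \sum_v A u v * (f u - f v) ^+ 2.
Proof.
case=> As Ws AD WS [I [phi [a [b [phiC EA EW ab]]]]].
have [V0|V0] := posnP #|V|.
  by rewrite !big_pred0 ?normr0 ?mulr0 // => u; have := card0_eq V0 u; rewrite inE.
have V1 : 0 < #|V|%:R :> R by rewrite ltr0n.
rewrite -(ler_pM2l V1) -[X in X * `|_|]ger0_norm ?(ltW V1) // -normrM mulrCA.
rewrite (energy_fourier f phiC EW Ws WS) (energy_fourier f phiC EA As AD).
rewrite normrM [`|2|]ger0_norm ?ler0n // mulrCA ler_pM2l ?ltr0n //.
apply: le_trans (ler_norm_sum _ _ _) _; rewrite mulr_sumr; apply: ler_sum => i _.
rewrite normrM [`|_ ^+ 2|]ger0_norm ?sqr_ge0 // [eps * _]mulrA.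
by rewrite ler_wpM2r ?sqr_ge0 //; exact: ab.
Qed.

Section Product.
Variables (V V' I I' : finType) (phi : I -> V -> C) (phi' : I' -> V' -> C).

Definition tensor_family (i : I * I') (u : V * V') : C := phi i.1 u.1 * phi' i.2 u.2.
Definition tensor_kernel (W : V -> V -> R) (W' : V' -> V' -> R) (u v : V * V') : R :=
  W u.1 v.1 * W' u.2 v.2.

Lemma sum_pairM (K : pzSemiRingType) (J J' : finType) (F : J -> K) (G : J' -> K) :
  \sum_(p : J * J') F p.1 * G p.2 = (\sum_i F i) * (\sum_j G j).
Proof. by rewrite big_distrlr /= pair_bigA. Qed.

Lemma complete_tensor : complete phi -> complete phi' -> complete tensor_family.
Proof.
move=> E E' [u u'] [v v']; rewrite card_prod natrM.
transitivity (\sum_(p : I * I') (phi p.1 u * (phi p.1 v)^*) * (phi' p.2 u' * (phi' p.2 v')^*)).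
  by apply: eq_bigr => p _; rewrite /tensor_family /= rmorphM /=; ring.
rewrite (sum_pairM (fun i => phi i u * (phi i v)^* )
  (fun i => phi' i u' * (phi' i v')^* )) E E'.
by rewrite xpair_eqE -mulnb natrM; ring.
Qed.

Lemma eigen_tensor W W' b b' : eigen phi W b -> eigen phi' W' b' ->
  eigen tensor_family (tensor_kernel W W') (fun i => b i.1 * b' i.2).
Proof.
move=> E E' [i i'] [u u'] /=.
transitivity (\sum_(p : V * V') (toC (W u p.1) * phi i p.1) * (toC (W' u' p.2) * phi' i' p.2)).
  by apply: eq_bigr => p _; rewrite /tensor_family /tensor_kernel rmorphM /=; ring.
rewrite (sum_pairM (fun v => toC (W u v) * phi i v)
  (fun v => toC (W' u' v) * phi' i' v)) E E'.
by rewrite /tensor_family rmorphM /=; ring.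
Qed.

Lemma rowsum_tensor W W' S S' : (forall u, \sum_v W u v = S) ->
  (forall u, \sum_v W' u v = S') -> forall u, \sum_v tensor_kernel W W' u v = S * S'.
Proof.
by move=> E E' [u u']; rewrite -(E u) -(E' u') -sum_pairM.
Qed.
End Product.

Definition cart_kernel (V V' : finType) (W : V -> V -> R) (W' : V' -> V' -> R) u v : R :=
  tensor_kernel W (@id_kernel V') u v + tensor_kernel (@id_kernel V) W' u v.

Lemma id_kernel_sym (V : finType) (u v : V) : id_kernel u v = id_kernel v u.
Proof. by rewrite /id_kernel eq_sym. Qed.

Lemma rowsum_id (V : finType) (u : V) : \sum_v id_kernel u v = 1.
Proof.
rewrite (bigD1 u) //= /id_kernel eqxx big1 ?addr0 // => v.
by rewrite eq_sym => /negPf->.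
Qed.

(** Tensor products of eigenvectors are eigenvectors, with the products of the
    eigenvalues. *)
Lemma diagonalized_tensor (V V' : finType) A W A' W' D S D' S' (P P' Q : R -> R -> Prop) :
  (forall a b a' b', P a b -> P' a' b' -> Q (a * a') (b * b')) ->
  @diagonalized V A W D S P -> @diagonalized V' A' W' D' S' P' ->
  diagonalized (tensor_kernel A A') (tensor_kernel W W') (D * D') (S * S') Q.
Proof.
move=> PQ [As Ws AD WS [I [phi [a [b [pC EA EW ab]]]]]].
move=> [As' Ws' AD' WS' [I' [phi' [a' [b' [pC' EA' EW' ab']]]]]].
split; try exact: rowsum_tensor.
- by move=> u v; rewrite /tensor_kernel As As'.
- by move=> u v; rewrite /tensor_kernel Ws Ws'.
exists (I * I')%type, (tensor_family phi phi'),
  (fun i => a i.1 * a' i.2), (fun i => b i.1 * b' i.2).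
split; [exact: complete_tensor | exact: eigen_tensor | exact: eigen_tensor |].
by move=> i; apply: PQ.
Qed.

(** The same eigenvectors as for the tensor product; a Cartesian kernel is a
    sum of two tensor kernels having the identity as a factor. *)
Lemma diagonalized_cart (V V' : finType) A W A' W' D S D' S' (P P' Q : R -> R -> Prop) :
  (forall a b a' b', P a b -> P' a' b' -> Q (a + a') (b + b')) ->
  @diagonalized V A W D S P -> @diagonalized V' A' W' D' S' P' ->
  diagonalized (cart_kernel A A') (cart_kernel W W') (D + D') (S + S') Q.
Proof.
move=> PQ [As Ws AD WS [I [phi [a [b [pC EA EW ab]]]]]].
move=> [As' Ws' AD' WS' [I' [phi' [a' [b' [pC' EA' EW' ab']]]]]].
have row (B : V -> V -> R) (B' : V' -> V' -> R) s s' : (forall u, \sum_v B u v = s) ->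
    (forall u, \sum_v B' u v = s') -> forall u, \sum_v cart_kernel B B' u v = s + s'.
  move=> Bs Bs' u; rewrite big_split /=.
  rewrite (rowsum_tensor Bs (@rowsum_id _)) (rowsum_tensor (@rowsum_id _) Bs').
  by rewrite mulr1 mul1r.
have eg (B : V -> V -> R) (B' : V' -> V' -> R) s s' : eigen phi B s -> eigen phi' B' s' ->
    eigen (tensor_family phi phi') (cart_kernel B B') (fun i => s i.1 + s' i.2).
  move=> Bs Bs'.
  have h := eigenD (eigen_tensor Bs (eigen_id phi')) (eigen_tensor (eigen_id phi) Bs').
  by move=> i u; rewrite h mulr1 mul1r.
split; try exact: row.
- by move=> u v; rewrite /cart_kernel /tensor_kernel As As' (id_kernel_sym u.1) (id_kernel_sym u.2).
- by move=> u v; rewrite /cart_kernel /tensor_kernel Ws Ws' (id_kernel_sym u.1) (id_kernel_sym u.2).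
exists (I * I')%type, (tensor_family phi phi'),
  (fun i => a i.1 + a' i.2), (fun i => b i.1 + b' i.2).
split; [exact: complete_tensor | exact: eg | exact: eg |].
by move=> i; apply: PQ.
Qed.

Lemma diagonalized_imp (V : finType) A W D S (P Q : R -> R -> Prop) :
  (forall a b, P a b -> Q a b) ->
  @diagonalized V A W D S P -> diagonalized A W D S Q.
Proof.
move=> PQ [As Ws AD WS [I [phi [a [b [pC EA EW ab]]]]]]; split=> //.
by exists I, phi, a, b; split=> // i; apply: PQ.
Qed.

(** In characteristic 0 the polynomial X^n - 1 is separable, so its roots are n
    distinct roots of unity. *)
Lemma prim_root_exists n : (0 < n)%N -> exists w : C, n.-primitive_root w.
Proof.
pose p : {poly C} := 'X^n - 1; have [r Dp] := closed_field_poly_normal p.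
move=> n_gt0; rewrite (monicP _) ?monicXnsubC // scale1r in Dp.
have rn1: all n.-unity_root r by apply/allP=> z; rewrite -root_prod_XsubC -Dp.
have sz_r: (n < (size r).+1)%N.
  by rewrite -(size_prod_XsubC r id) -Dp size_XnsubC.
have [|z] := hasP (has_prim_root n_gt0 rn1 _ sz_r); last by exists z.
by rewrite -separable_prod_XsubC -Dp separable_Xn_sub_1 // pnatr_eq0 -lt0n.
Qed.

End Spectral.

(** * Signed circulant graphs are diagonalized by characters *)

Definition circ_dist (n i j : nat) : nat :=
  let e := ((i - j) + (j - i))%N in minn e (n - e).

Lemma circ_distC n i j : circ_dist n i j = circ_dist n j i.
Proof. by rewrite /circ_dist addnC. Qed.

Lemma circ_dist_shift m (u x : 'I_m.+2) : circ_dist m.+2 u (u + x)%R = minn x (m.+2 - x).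
Proof.
rewrite /circ_dist /=; have := ltn_ord u; have := ltn_ord x.
have [h|h] := ltnP (u + x) m.+2 => un xn.
  by rewrite modn_small //; lia.
have -> : ((u + x) %% m.+2 = u + x - m.+2)%N.
  by rewrite -{1}(subnK h) modnDr modn_small //; lia.
lia.
Qed.

Section Circ.
Variable R : realType.
Local Notation C := R[i].
Local Notation modulus := (@Normc.normc R).
Local Notation toC := (real_complex R).

Lemma dcos_conj (z : C) j : z ^+ j + (z ^+ j)^* = toC (dcos z j).
Proof.
rewrite /dcos rmorphM rmorph_nat /=; case: (z ^+ j) => a b /=.
by rewrite -[(_ +i* _)%C^*]/(a -i* b)%C; simpc; congr Complex; ring.
Qed.

Lemma unit_conj (z : C) : modulus z = 1 -> z * z^* = 1.
Proof. by move=> z1; rewrite modulus_sqr z1 expr1n. Qed.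

Section Fold.
Variables (n k : nat) (g : nat -> R) (z : C).
Hypotheses (kn : (2 * k < n)%N) (zn : z ^+ n = 1) (z1 : modulus z = 1).
Hypothesis g_supp : forall e, ~~ (0 < e <= k)%N -> g e = 0.

Lemma expr_conj j : (j <= n)%N -> z ^+ (n - j) = (z ^+ j)^*.
Proof.
move=> jn; have u : modulus (z ^+ j) = 1 by rewrite modulusX z1 expr1n.
have zj : z ^+ j != 0.
  by apply/eqP => e; move: u; rewrite e modulus0 => /eqP; rewrite eq_sym oner_eq0.
by apply: (mulfI zj); rewrite unit_conj // -exprD subnKC.
Qed.

(** The points x and n - x lie at the same distance and contribute conjugate
    powers of z; 2 k < n keeps the two halves apart. *)
Lemma fold_sum : \sum_(x < n) toC (g (minn x (n - x))) * z ^+ x =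
  toC (\sum_(j < k) g j.+1 * dcos z j.+1).
Proof.
pose F x := toC (g (minn x (n - x))) * z ^+ x.
have Fz x : (0 < minn x (n - x) <= k)%N = false -> F x = 0.
  by move=> h; rewrite /F g_supp ?rmorph0 ?mul0r ?h.
have [n1 k1 k2 k3] : [/\ 1 <= n, k.+1 <= n, k.+1 <= n - k & n - k <= n]%N.
  by split; lia.
rewrite -(big_mkord xpredT F) (big_cat_nat (leq0n 1) n1) /=.
rewrite big_nat1 Fz ?min0n // add0r.
rewrite (big_cat_nat (ltn0Sn k) k1) (big_cat_nat k2 k3) /=.
have -> : \sum_(k.+1 <= x < n - k) F x = 0.
  by rewrite big_nat big1 // => x /andP[h1 h2]; apply: Fz; apply/negbTE; lia.
rewrite add0r.
have -> : \sum_(1 <= x < k.+1) F x = \sum_(j < k) toC (g j.+1) * z ^+ j.+1.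
  rewrite big_add1 big_mkord; apply: eq_bigr => j _; rewrite /F.
  by have -> : minn j.+1 (n - j.+1) = j.+1 by have := ltn_ord j; lia.
have -> : \sum_(n - k <= x < n) F x = \sum_(j < k) toC (g j.+1) * (z ^+ j.+1)^*.
  rewrite -{1}[(n - k)%N]add0n big_addn subKn; last by lia.
  rewrite big_nat_rev big_mkord /=; apply: eq_bigr => j _; rewrite /F.
  have jk := ltn_ord j.
  have -> : (0 + k - j.+1 + (n - k) = n - j.+1)%N by lia.
  rewrite expr_conj; last by lia.
  by have -> : minn (n - j.+1) (n - (n - j.+1)) = j.+1 by lia.
rewrite -big_split rmorph_sum /=; apply: eq_bigr => j _.
by rewrite -mulrDr dcos_conj; exact/esym/(rmorphM (real_complex R)).
Qed.
End Fold.

Section Cyclic.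
Variables (m : nat) (w : C).
Local Notation n := m.+2.
Hypothesis w_prim : n.-primitive_root w.

Lemma modulus_prim : modulus w = 1.
Proof.
have : modulus w ^+ n = 1 by rewrite -modulusX (prim_expr_order w_prim) modulus1.
by move/eqP; rewrite pexpr_eq1 // ?modulus_ge0 // => /eqP.
Qed.

Definition expchar (t u : 'I_n) : C := w ^+ (t * u).

(** Orthogonality of characters: a geometric sum of powers of a nontrivial n-th
    root of unity vanishes. *)
Lemma complete_expchar : complete expchar.
Proof.
move=> u v; rewrite card_ord.
pose q := w ^+ u * (w ^+ v)^*.
have nv : modulus (w ^+ v) = 1 by rewrite modulusX modulus_prim expr1n.
transitivity (\sum_(t < n) q ^+ t).
  apply: eq_bigr => t _; rewrite /expchar /q exprMn -!exprM !rmorphXn /= -!exprM.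
  by rewrite !(mulnC t).
have [uv|uv] := eqVneq u v.
  have -> : q = 1 by rewrite /q uv unit_conj.
  by rewrite mulr1; under eq_bigr => t _ do rewrite expr1n; rewrite sumr_const card_ord.
rewrite mulr0; have q1 : q - 1 != 0.
  rewrite subr_eq0; apply: contra uv => /eqP q1.
  have /eqP : w ^+ u = w ^+ v.
    by rewrite -[LHS]mulr1 -(unit_conj nv) [w ^+ v * _]mulrC mulrA -/q q1 mul1r.
  by rewrite (eq_prim_root_expr w_prim) !modn_small // => /eqP/ord_inj->.
apply: (mulfI q1); rewrite mulr0 -subrX1 /q exprMn -rmorphXn /= -!exprM ![(_ * n)%N]mulnC.
by rewrite !exprM (prim_expr_order w_prim) !expr1n conjC1 mulr1 subrr.
Qed.

Variables (k : nat) (g : nat -> R).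
Hypothesis kn : (2 * k < n)%N.
Hypothesis g_supp : forall e, ~~ (0 < e <= k)%N -> g e = 0.

(** A kernel depending on the circular distance is a convolution. *)
Lemma eigen_expchar :
  eigen expchar (fun u v : 'I_n => g (circ_dist n u v))
        (fun t => \sum_(j < k) g j.+1 * dcos (w ^+ t) j.+1).
Proof.
move=> t u; rewrite (reindex (fun x : 'I_n => u + x)); last first.
  by exists (fun x => x - u) => x _; [rewrite addrC addKr | rewrite addrC subrK].
have tn : (w ^+ t) ^+ n = 1.
  by rewrite -exprM mulnC exprM (prim_expr_order w_prim) expr1n.
have t1 : modulus (w ^+ t) = 1 by rewrite modulusX modulus_prim expr1n.
rewrite -(fold_sum kn tn t1 g_supp) mulr_suml; apply: eq_bigr => x _.
rewrite circ_dist_shift -mulrA; congr (_ * _); rewrite /expchar -exprM.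
rewrite -exprD -mulnDr addnC -[in LHS](prim_expr_mod w_prim) /= modnMmr.
by rewrite (prim_expr_mod w_prim).
Qed.

(** The row sum is the eigenvalue of the trivial character. *)
Lemma rowsum_expchar (u : 'I_n) :
  \sum_(v : 'I_n) g (circ_dist n u v) = 2 * \sum_(j < k) g j.+1.
Proof.
apply: (@complexI R); have := eigen_expchar ord0 u.
rewrite /expchar mul0n expr0 mulr1 => h.
have -> : 2 * \sum_(j < k) g j.+1 = \sum_(j < k) g j.+1 * dcos 1 j.+1.
  by rewrite mulr_sumr; apply: eq_bigr => j _; rewrite dcos1 mulrC.
rewrite -h rmorph_sum; apply: eq_bigr => v _.
by rewrite mulr1.
Qed.
End Cyclic.

(** The distance 0 receives sign +1, so that in a product the coordinates that do
    not move do not affect the sign of an edge. *)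
Definition dist_sign (e : nat) : bool := (0 < e)%N && rudin_shapiro e.-1.
Definition adj_weight (k e : nat) : R := (0 < e <= k)%N%:R.
Definition signed_weight (k e : nat) : R := (-1) ^+ dist_sign e * adj_weight k e.

Lemma diagonalized_cyclic m k (P : R -> R -> Prop) : (2 * k < m.+2)%N ->
  (forall z : C, modulus z = 1 ->
    P (\sum_(j < k) dcos z j.+1) (\sum_(j < k) rs_sign j * dcos z j.+1)) ->
  diagonalized (fun u v : 'I_m.+2 => adj_weight k (circ_dist m.+2 u v))
    (fun u v : 'I_m.+2 => signed_weight k (circ_dist m.+2 u v))
    (2 * k%:R) (2 * \sum_(j < k) rs_sign j) P.
Proof.
move=> kn PE; have [w w_prim] := prim_root_exists R (ltn0Sn m.+1).
have As e : ~~ (0 < e <= k)%N -> adj_weight k e = 0 by rewrite /adj_weight => /negPf->.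
have Ws e : ~~ (0 < e <= k)%N -> signed_weight k e = 0.
  by rewrite /signed_weight => /As->; rewrite mulr0.
have AE (j : 'I_k) : adj_weight k j.+1 = 1 by rewrite /adj_weight ltn_ord.
have WE (j : 'I_k) : signed_weight k j.+1 = rs_sign j by rewrite /signed_weight AE mulr1.
split.
- by move=> u v; rewrite circ_distC.
- by move=> u v; rewrite circ_distC.
- move=> u; rewrite (rowsum_expchar w_prim kn As).
  by under eq_bigr => j _ do rewrite AE; rewrite sumr_const card_ord.
- move=> u; rewrite (rowsum_expchar w_prim kn Ws).
  by under eq_bigr => j _ do rewrite WE.
exists 'I_m.+2, (@expchar m w),
  (fun t : 'I_m.+2 => \sum_(j < k) adj_weight k j.+1 * dcos (w ^+ t) j.+1),
  (fun t : 'I_m.+2 => \sum_(j < k) signed_weight k j.+1 * dcos (w ^+ t) j.+1).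
split.
- exact: complete_expchar.
- exact: eigen_expchar.
- exact: eigen_expchar.
move=> t; have t1 : modulus (w ^+ t) = 1 by rewrite modulusX (modulus_prim w_prim) expr1n.
under eq_bigr => j _ do rewrite AE mul1r.
under [X in P _ X]eq_bigr => j _ do rewrite WE.
exact: PE.
Qed.
End Circ.

(** * A program comparing digits of vertex numbers *)

Section RandomAccessProgram.
Local Open Scope nat_scope.

(** A weakest precondition style specification with an upper bound on the
    running time. *)
Definition run (p : rcmd) (m : memory) (Q : memory -> Prop) (T : nat) : Prop :=
  exists m' t, [/\ rexec p m m' t, t <= T & Q m'].

Lemma run_weaken p m (Q Q' : memory -> Prop) T T' :
  run p m Q T -> T <= T' -> (forall m', Q m' -> Q' m') -> run p m Q' T'.
Proof.
move=> [m' [t [ex tT Qm']]] TT' QQ'; exists m', t.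
by split; [|exact: leq_trans TT'|exact: QQ'].
Qed.

Lemma run_put a e1 e2 m (Q : memory -> Prop) :
  Q (mem_set m a (reval m e1) (reval m e2)) -> run (RPut a e1 e2) m Q 1.
Proof. by move=> Qm; eexists _, _; split; [apply: exec_put| |]. Qed.

Lemma run_seq p1 p2 m (Q1 Q2 : memory -> Prop) T1 T2 :
  run p1 m Q1 T1 -> (forall m1, Q1 m1 -> run p2 m1 Q2 T2) ->
  run (RSeq p1 p2) m Q2 (T1 + T2).+1.
Proof.
move=> [m1 [t1 [ex1 le1 Q1m]]] /(_ _ Q1m) [m2 [t2 [ex2 le2 Q2m]]].
exists m2, (t1 + t2).+1; split=> //; first exact: exec_seq ex1 ex2.
by rewrite ltnS leq_add.
Qed.

Lemma run_put_seq a e1 e2 p m (Q : memory -> Prop) T :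
  run p (mem_set m a (reval m e1) (reval m e2)) Q T ->
  run (RSeq (RPut a e1 e2) p) m Q T.+2.
Proof.
move=> h; apply: (@run_seq _ _ _ (eq (mem_set m a (reval m e1) (reval m e2))) Q 1).
  exact: run_put.
by move=> m1 <-.
Qed.

(** Indexing the invariant by the number of completed rounds gives termination
    and the time bound at once. *)
Lemma run_while e p (I : nat -> memory -> Prop) N T m :
  I 0 m ->
  (forall i m, i < N -> I i m -> reval m e != 0 /\ run p m (I i.+1) T) ->
  (forall m, I N m -> reval m e = 0) ->
  run (RWhile e p) m (I N) (N * T.+1).+1.
Proof.
move=> I0 step stop.
suff gen j i m' : i + j = N -> I i m' -> run (RWhile e p) m' (I N) (j * T.+1).+1.
  exact: (gen N 0 m).
elim: j i m' => [|j IH] i m'.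
  rewrite addn0 => -> INm; exists m', 1; split=> //.
  by apply: exec_while_false; apply: stop.
move=> ij Im; have iN : i < N by lia.
have [ne [m1 [t1 [ex1 le1 I1]]]] := step i m' iN Im.
have [m2 [t2 [ex2 le2 I2]]] := IH i.+1 m1 ltac:(lia) I1.
exists m2, (t1 + t2).+1; split=> //; first exact: exec_while_true ex1 ex2.
by rewrite mulSn; lia.
Qed.

(* Array 5 holds the sign table; arrays from 6 on are registers, of which only
   cell 0 is used. *)
Local Notation aPos := 3.
Local Notation aNeg := 4.
Local Notation aTab := 5.
Local Notation vN := 6.
Local Notation vR := 7.
Local Notation vC := 8.
Local Notation vIdx := 9.
Local Notation vH := 10.
Local Notation vQ := 11.
Local Notation vQ' := 12.
Local Notation vCnt := 13.
Local Notation vBad := 14.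
Local Notation vSg := 15.
Local Notation vT := 16.
Local Notation vT' := 17.
Local Notation vE := 18.
Local Notation vX := 19.
Local Notation vPar := 20.

Definition rvar (a : nat) : rexp := RGet a (RConst 0).
Definition rset (a : nat) (e : rexp) : rcmd := RPut a (RConst 0) e.
Definition rinc (a : nat) : rcmd := rset a (RAdd (rvar a) (RConst 1)).
(** Truncated subtraction turns this into the distance of two numbers, which is
    the exclusive or on bits. *)
Definition rxor (e1 e2 : rexp) : rexp := RAdd (RSub e1 e2) (RSub e2 e1).

Definition power_prog : rcmd :=
  RSeq (rset vN (RConst 1)) (RSeq (rset vH (RConst 0))
  (RWhile (RSub (rvar 1) (rvar vH))
    (RSeq (rset vT (RConst 0)) (RSeq (rset vX (RConst 0))
    (RSeq
      (RWhile (RSub (rvar 0) (rvar vX))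
        (RSeq (rset vT (RAdd (rvar vT) (rvar vN))) (rinc vX)))
    (RSeq (rset vN (rvar vT)) (rinc vH))))))).

(** Fills the table of dist_sign, two entries per round, by the doubling rules of
    the Rudin-Shapiro sequence shifted by one. *)
Definition table_prog : rcmd :=
  RSeq (rset vPar (RConst 0)) (RSeq (rset vX (RConst 0))
  (RSeq (RPut aTab (RConst 0) (RConst 0)) (RSeq (RPut aTab (RConst 1) (RConst 0))
  (RWhile (RSub (rvar 0) (rvar vX))
    (RSeq (RPut aTab (RAdd (RAdd (rvar vX) (rvar vX)) (RConst 1))
                     (RGet aTab (RAdd (rvar vX) (RConst 1))))
    (RSeq (RPut aTab (RAdd (RAdd (rvar vX) (rvar vX)) (RConst 2))
                     (rxor (RGet aTab (RAdd (rvar vX) (RConst 1))) (rvar vPar)))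
    (RSeq (rset vPar (RSub (RConst 1) (rvar vPar))) (rinc vX)))))))).

(** Leaves the remainder modulo n in q and the quotient in t. *)
Definition div_prog (q t : nat) : rcmd :=
  RSeq (rset t (RConst 0))
  (RWhile (RSub (RAdd (rvar q) (RConst 1)) (rvar 0))
    (RSeq (rset q (RSub (rvar q) (rvar 0))) (rinc t))).

Definition digit_prog : rcmd :=
  RSeq (rset vH (RSub (rvar vH) (RConst 1)))
  (RSeq (div_prog vQ vT) (RSeq (div_prog vQ' vT')
  (RSeq (rset vE (rxor (rvar vQ) (rvar vQ')))
  (RSeq (rset vE (RSub (rvar vE) (RSub (rvar vE) (RSub (rvar 0) (rvar vE)))))
  (RSeq (rset vCnt (RAdd (rvar vCnt) (RSub (RConst 1) (RSub (RConst 1) (rvar vE)))))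
  (RSeq (rset vBad (RAdd (rvar vBad) (RSub (rvar vE) (RGet 2 (rvar vH)))))
  (RSeq (rset vSg (rxor (rvar vSg) (RGet aTab (rvar vE))))
  (RSeq (rset vQ (rvar vT)) (rset vQ' (rvar vT')))))))))).

Definition scan_prog : rcmd :=
  RSeq (rset vQ (rvar vR)) (RSeq (rset vQ' (rvar vC))
  (RSeq (rset vCnt (RConst 0)) (RSeq (rset vBad (RConst 0))
  (RSeq (rset vSg (RConst 0)) (RSeq (rset vH (rvar 1))
  (RWhile (rvar vH) digit_prog)))))).

(** Equal to 1 iff there is no excess and the digit count is on target, and to 0
    otherwise. *)
Definition edge_exp (tgt : rexp) : rexp :=
  RSub (RConst 1) (RAdd (rvar vBad) (rxor (rvar vCnt) tgt)).

Definition cell_prog (tgt : rexp) : rcmd :=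
  RSeq scan_prog
  (RSeq (RPut aPos (rvar vIdx) (RSub (edge_exp tgt) (rvar vSg)))
  (RSeq (RPut aNeg (rvar vIdx) (RSub (edge_exp tgt) (RSub (RConst 1) (rvar vSg))))
  (RSeq (rinc vIdx) (rinc vC)))).

Definition main_prog (tgt : rexp) : rcmd :=
  RSeq power_prog (RSeq table_prog
  (RSeq (rset vR (RConst 0)) (RSeq (rset vIdx (RConst 0))
  (RWhile (RSub (rvar vN) (rvar vR))
    (RSeq (rset vC (RConst 0))
    (RSeq (RWhile (RSub (rvar vN) (rvar vC)) (cell_prog tgt)) (rinc vR))))))).

(** The vertex numbers r and r' are read in base n, last digit first; l lists the
    bounds k_h in the matching reversed order. *)
Fixpoint digit_diff (n : nat) (l : seq nat) (r r' : nat) : nat :=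
  if l is k :: l' then
    (0 < circ_dist n (r %% n) (r' %% n)) + digit_diff n l' (r %/ n) (r' %/ n)
  else 0.

Fixpoint digit_excess (n : nat) (l : seq nat) (r r' : nat) : nat :=
  if l is k :: l' then
    (circ_dist n (r %% n) (r' %% n) - k) + digit_excess n l' (r %/ n) (r' %/ n)
  else 0.

Fixpoint digit_sign (n : nat) (l : seq nat) (r r' : nat) : bool :=
  if l is k :: l' then
    dist_sign (circ_dist n (r %% n) (r' %% n)) (+) digit_sign n l' (r %/ n) (r' %/ n)
  else false.

Definition digit_edge n l tgt r r' : bool :=
  (digit_excess n l r r' == 0) && (digit_diff n l r r' == tgt).

Section Run.
Variables (n d : nat) (ks : seq nat).
Hypotheses (n1 : 1 < n) (d0 : 0 < d) (ksd : size ks = d).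
Local Notation N := (n ^ d).

Let nN : n <= N.
Proof. by rewrite -{1}(expn1 n) leq_exp2l. Qed.

Let dN : d <= N.
Proof. exact: ltnW (ltn_expl _ n1). Qed.

Definition holds_input (m : memory) : Prop :=
  [/\ m 0 0 = n, m 1 0 = d & forall h, m 2 h = nth 0 ks h].

Lemma power_run m : holds_input m ->
  run power_prog m (fun m' => holds_input m' /\ m' vN 0 = N) (30 * N ^ 2).
Proof.
move=> inp; pose I h m := holds_input m /\ (m vN 0 = n ^ h /\ m vH 0 = h).
apply: (@run_weaken _ _ (I d) _ (d * ((n * 4).+1 + 3).+1.+4.+1).+1.+4).
- apply: run_put_seq; apply: run_put_seq; apply: run_while.
  + by case: inp => *; split; [split|].
  + move=> h m1 hd [inp1 [eN eH]]; split.
      by case: inp1 => /= _ -> _; rewrite eH; lia.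
    apply: run_put_seq; apply: run_put_seq.
    pose J i m := [/\ holds_input m, m vN 0 = n ^ h, m vH 0 = h,
                      m vT 0 = i * n ^ h & m vX 0 = i].
    apply: (@run_seq _ _ _ (J n)).
      apply: run_while.
      * by case: inp1 => *; split; [split| | | |].
      * move=> i m2 iN [[e0 e1 e2] E1 E2 E3 E4]; split; first by rewrite /= e0 E4; lia.
        apply: run_put_seq; apply: run_put.
        split; [by split|by []|by []| |]; rewrite /mem_set /= ?E1 ?E3 ?E4 ?addn1 //.
        by rewrite mulSn addnC.
      * by move=> m2 [[e0 _ _] _ _ _ E4]; rewrite /= e0 E4 subnn.
    move=> m2 [[e0 e1 e2] E1 E2 E3 E4].
    apply: run_put_seq; apply: run_put.
    split; [by split|split]; rewrite /mem_set /= ?E2 ?E3 ?expnS ?addn1 //.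
  + by move=> m1 [[_ e1 _] [_ e2]]; rewrite /= e1 e2 subnn.
- by move: N nN dN => M h1 h2; nia.
- by move=> m' [? []].
Qed.

Lemma table_run m : holds_input m -> m vN 0 = N ->
  run table_prog m (fun m' => [/\ holds_input m', m' vN 0 = N &
    forall e, e <= n -> m' aTab e = dist_sign e]) (30 * N).
Proof.
move=> inp eN.
pose I x m := [/\ holds_input m, m vN 0 = N, m vX 0 = x, m vPar 0 = odd x &
  forall e, e <= maxn 1 x.*2 -> m aTab e = dist_sign e].
apply: (@run_weaken _ _ (I n) _ (n * 8).+1.+4.+4).
- do 4 apply: run_put_seq.
  apply: run_while.
  + case: inp => *; split; [by split|by []|by []|by []|].
    by case=> [|[|e]].
  + move=> x m1 xn [[e0 e1 e2] E1 E2 E3 E4]; split; first by rewrite /= e0 E2; lia.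
    do 3 apply: run_put_seq; apply: run_put.
    have tx : m1 aTab x.+1 = rudin_shapiro x by rewrite E4 //; lia.
    split; [by split|by []| | |]; rewrite /mem_set /= ?E2 ?E3 ?addn1 //.
      by case: odd.
    move=> e; rewrite maxnE doubleS => he; rewrite !addnn addn2.
    have -> : (if x.+1 == x.*2.+1 then m1 aTab x.+1 else m1 aTab x.+1) = m1 aTab x.+1.
      by case: ifP.
    case: eqP => [->|n2]; first rewrite tx /dist_sign /= rudin_shapiro_doubleS.
      by case: rudin_shapiro; case: odd.
    case: eqP => [->|n3]; first by rewrite tx /dist_sign /= rudin_shapiro_double.
    by apply: E4; lia.
  + by move=> m1 [[e0 _ _] _ E2 _ _]; rewrite /= e0 E2 subnn.
- by move: N nN => M h1; nia.
- by move=> m' [h1 h2 h3 h4 h5]; split=> // e en; apply: h5; lia.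
Qed.

Lemma div_run q t m : m 0 0 = n -> q != t -> q != 0 -> t != 0 -> m q 0 < N ->
  run (div_prog q t) m (fun m' => [/\ m' t 0 = m q 0 %/ n, m' q 0 = m q 0 %% n &
    forall a i, a != q -> a != t -> m' a i = m a i]) (10 * N).
Proof.
move=> e0 qt q0 t0 qN.
pose I i m' := [/\ m' t 0 = i, m' q 0 = m q 0 - i * n &
  forall a j, a != q -> a != t -> m' a j = m a j].
apply: (@run_weaken _ _ (I (m q 0 %/ n)) _ (m q 0 %/ n * 4).+1.+2).
- apply: run_put_seq; apply: run_while.
  + split; rewrite /mem_set ?eqxx ?(negPf qt) //= ?mul0n ?subn0 //.
    by move=> a j _ /negPf->.
  + move=> i m1 iN [E1 E2 E3].
    have m0 : m1 0 0 = n by rewrite E3 // eq_sym.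
    have := divn_eq (m q 0) n; have := ltn_pmod (m q 0) (ltnW n1).
    set Q := m q 0 %/ n in iN *; set r := m q 0 %% n => rn qE.
    have le : i.+1 * n <= Q * n by rewrite leq_pmul2r ?(ltnW n1).
    split; first by rewrite /= E2 m0 mulSn in le *; lia.
    apply: run_put_seq; apply: run_put; split.
    * by rewrite /mem_set /= !eqxx /= [t == q]eq_sym (negPf qt) /= E1 addn1.
    * by rewrite /mem_set /= (negPf qt) !eqxx /= E2 m0; lia.
    * by move=> a j aq ta; rewrite /mem_set (negPf aq) (negPf ta) /= E3.
  + move=> m1 [E1 E2 E3]; have m0 : m1 0 0 = n by rewrite E3 // eq_sym.
    rewrite /= E2 m0; have := divn_eq (m q 0) n.
    by have := ltn_pmod (m q 0) (ltnW n1); lia.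
- have : m q 0 %/ n <= m q 0 by exact: leq_div.
  by move: N qN => M; lia.
- move=> m' [E1 E2 E3]; split=> //; rewrite E2.
  by rewrite {1}(divn_eq (m q 0) n) addKn.
Qed.

(** What the scanning phase needs from the two preparatory phases. *)
Definition ready (m : memory) : Prop :=
  [/\ holds_input m, m vN 0 = N & forall e, e <= n -> m aTab e = dist_sign e].

Definition frame (l : seq nat) (m m' : memory) : Prop :=
  forall a i, a \notin l -> m' a i = m a i.

Lemma ready_frame l m m' :
  frame l m m' -> all (fun a => a \notin l) [:: 0; 1; 2; aTab; vN] ->
  ready m -> ready m'.
Proof.
move=> fr /and5P[h0 h1 h2 h5 /andP[h6 _]] [[e0 e1 e2] E1 E2].
by split; [split| |] => *; rewrite fr ?e0 ?e1 ?e2 ?E1 ?E2.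
Qed.

Lemma ready_set m a i x : a \notin [:: 0; 1; 2; aTab; vN] ->
  ready m -> ready (mem_set m a i x).
Proof.
move=> an; apply: (@ready_frame [:: a]).
  by move=> b j; rewrite /mem_set inE => /negPf->.
by apply/allP => b bin; rewrite inE; apply: contraNneq an => <-.
Qed.

Lemma addb_nat (a b : bool) : (a - b) + (b - a) = a (+) b :> nat.
Proof. by case: a; case: b. Qed.

Let scan_regs := [:: vH; vQ; vQ'; vCnt; vBad; vSg; vT; vT'; vE].

Lemma digit_run m h (s : bool) : ready m -> m vH 0 = h.+1 ->
    m vQ 0 < N -> m vQ' 0 < N -> m vSg 0 = s ->
  let e := circ_dist n (m vQ 0 %% n) (m vQ' 0 %% n) in
  run digit_prog m (fun m' => frame scan_regs m m' /\
    [/\ m' vH 0 = h, m' vQ 0 = m vQ 0 %/ n, m' vQ' 0 = m vQ' 0 %/ n &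
    [/\ m' vCnt 0 = m vCnt 0 + (0 < e), m' vBad 0 = m vBad 0 + (e - nth 0 ks h) &
        m' vSg 0 = s (+) dist_sign e]]) (60 * N).
Proof.
move=> [[e0 e1 e2] eN tab] eH qN q'N eS e.
apply: (@run_weaken _ _ _ _ (10 * N + (10 * N + 13).+1).+1.+2); last 2 first.
- by move: N nN => M; lia.
- by move=> m' h'; exact: h'.
apply: run_put_seq; set m1 := mem_set _ _ _ _.
have m1E a i : a != vH -> m1 a i = m a i by rewrite /m1 /mem_set => /negPf->.
have m1H : m1 vH 0 = h by rewrite /m1 /mem_set /= eH subn1.
apply: run_seq; first by apply: div_run; rewrite ?m1E.
move=> m2 []; rewrite [m1 vQ 0]m1E // => T2 Q2 f2.
apply: run_seq; first by apply: div_run; rewrite // ?f2 // m1E.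
move=> m3 []; rewrite [m2 vQ' 0]f2 // m1E // => T3 Q3 f3.
have en : e <= n.
  by rewrite /e /circ_dist; have := ltn_pmod (m vQ 0) (ltnW n1);
     have := ltn_pmod (m vQ' 0) (ltnW n1); lia.
have fr3 a i : a \notin scan_regs -> m3 a i = m a i.
  rewrite !inE !negb_or => /and5P[? ? ? ? /and5P[? ? ? ? ?]].
  by rewrite f3 // f2 // m1E.
have q3 : m3 vQ 0 = m vQ 0 %% n by rewrite f3 // Q2.
have t3 : m3 vT 0 = m vQ 0 %/ n by rewrite f3 // T2.
have o3 a : a \in [:: vCnt; vBad; vSg; vH] -> m3 a 0 = m1 a 0.
  by rewrite !inE => /or4P[]/eqP->; rewrite f3 // f2.
have c3 : m3 vCnt 0 = m vCnt 0 by rewrite o3 // m1E.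
have b3 : m3 vBad 0 = m vBad 0 by rewrite o3 // m1E.
have s3 : m3 vSg 0 = s by rewrite o3 // m1E.
have h3 : m3 vH 0 = h by rewrite o3.
have n3 : m3 0 0 = n by rewrite fr3.
have k3 : m3 2 h = nth 0 ks h by rewrite fr3.
have tab3 : m3 aTab e = dist_sign e by rewrite fr3 // tab.
clearbody m1; clear m1E m1H f2 f3 o3.
do 6 apply: run_put_seq; apply: run_put.
have eE : (m vQ 0 %% n - m vQ' 0 %% n + (m vQ' 0 %% n - m vQ 0 %% n)) -
   ((m vQ 0 %% n - m vQ' 0 %% n + (m vQ' 0 %% n - m vQ 0 %% n)) -
    (n - (m vQ 0 %% n - m vQ' 0 %% n + (m vQ' 0 %% n - m vQ 0 %% n)))) = e.
  by rewrite /e /circ_dist; lia.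
split.
  move=> a i ha; rewrite -fr3 //; move: ha; rewrite /mem_set !inE !negb_or.
  move=> /and5P[A1 /negPf A2 /negPf A3 /negPf A4 /and5P[/negPf A5 /negPf A6 _ _ /negPf A7]].
  by rewrite A2 A3 A4 A5 A6 A7.
rewrite /mem_set /= q3 Q3 n3 h3 t3 c3 b3 s3 T3 eE k3 tab3 addb_nat.
by split=> //; split=> //; lia.
Qed.

(** Invariant of the loop: accumulated value plus the value still to be read off
    the remaining digits is the value for the whole vertex numbers. *)
Lemma scan_run m : ready m -> m vR 0 < N -> m vC 0 < N ->
  run scan_prog m (fun m' => frame scan_regs m m' /\
    [/\ m' vCnt 0 = digit_diff n (rev ks) (m vR 0) (m vC 0),
        m' vBad 0 = digit_excess n (rev ks) (m vR 0) (m vC 0) &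
        m' vSg 0 = digit_sign n (rev ks) (m vR 0) (m vC 0)]) (80 * N ^ 2).
Proof.
move=> rm rN cN; set r := m vR 0 in rN *; set c := m vC 0 in cN *.
pose I i m' := [/\ frame scan_regs m m', m' vH 0 = d - i, m' vQ 0 < N, m' vQ' 0 < N &
  exists2 s : bool, m' vSg 0 = s &
  let l := drop i (rev ks) in
  [/\ m' vCnt 0 + digit_diff n l (m' vQ 0) (m' vQ' 0) = digit_diff n (rev ks) r c,
      m' vBad 0 + digit_excess n l (m' vQ 0) (m' vQ' 0) = digit_excess n (rev ks) r c &
      s (+) digit_sign n l (m' vQ 0) (m' vQ' 0) = digit_sign n (rev ks) r c]].
apply: (@run_weaken _ _ (I d) _ (d * (60 * N).+1).+1.+4.+4.+4).
- do 6 apply: run_put_seq; apply: run_while.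
  + split=> //; rewrite /mem_set /=; last 1 first.
    * by exists false; rewrite // drop0.
    * move=> a i; rewrite !inE !negb_or.
      move=> /and5P[/negPf A1 /negPf A2 /negPf A3 /negPf A4 /and5P[/negPf A5 /negPf A6 _ _ _]].
      by rewrite A1 A2 A3 A4 A5 A6.
    * by rewrite subn0; case: rm => [[]].
  + move=> i m1 id [fr eH qN q'N [s eS [C B S]]]; split; first by rewrite /= eH; lia.
    have rm1 : ready m1 by apply: ready_frame fr _ rm.
    have eH' : m1 vH 0 = (d - i.+1).+1 by rewrite eH; lia.
    apply: run_weaken (digit_run rm1 eH' qN q'N eS) (leqnn _) _.
    move=> m2 [fr2 [eH2 Q2 Q2' [C2 B2 S2]]].
    have dr : drop i (rev ks) = nth 0 ks (d - i.+1) :: drop i.+1 (rev ks).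
      by rewrite (drop_nth 0) ?size_rev ?ksd // nth_rev ksd.
    split=> //.
    * by move=> a j ha; rewrite fr2 // fr.
    * by rewrite Q2; apply: leq_ltn_trans (leq_div _ _) qN.
    * by rewrite Q2'; apply: leq_ltn_trans (leq_div _ _) q'N.
    exists (s (+) dist_sign (circ_dist n (m1 vQ 0 %% n) (m1 vQ' 0 %% n))) => //=.
    by rewrite C2 B2 Q2 Q2' -C -B -S dr /= !addnA addbA.
  + by move=> m1 [_ eH _ _ _]; rewrite /= eH subnn.
- by move: N nN dN => M; nia.
move=> m' [fr _ _ _ [s eS]]; rewrite drop_oversize ?size_rev ?ksd //= !addn0 addbF.
by move=> [<- <- <-]; split.
Qed.

Variables (tgt : rexp) (tg : nat).
Hypothesis tgtE : forall m, m 1 0 = d -> reval m tgt = tg.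
Local Notation edge := (digit_edge n (rev ks) tg).

Lemma cell_run m r c : ready m -> m vR 0 = r -> m vC 0 = c -> r < N -> c < N ->
  run (cell_prog tgt) m (fun m' => frame [:: aPos, aNeg, vIdx, vC & scan_regs] m m' /\
    [/\ m' vIdx 0 = (m vIdx 0).+1, m' vC 0 = c.+1,
      forall i, m' aPos i = if i == m vIdx 0
        then nat_of_bool (edge r c && ~~ digit_sign n (rev ks) r c) else m aPos i &
      forall i, m' aNeg i = if i == m vIdx 0
        then nat_of_bool (edge r c && digit_sign n (rev ks) r c) else m aNeg i]) (90 * N ^ 2).
Proof.
move=> rm eR eC rN cN.
have E1 : m vR 0 < N by rewrite eR.
have E2 : m vC 0 < N by rewrite eC.
apply: (@run_weaken _ _ _ _ (80 * N ^ 2 + 7).+1); last 2 first.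
- by move: N nN => M; nia.
- by move=> m' h'; exact: h'.
apply: run_seq; first exact: scan_run.
rewrite eR eC => m1 [fr [C1 B1 S1]].
have rm1 : ready m1 by apply: ready_frame fr _ rm.
have o a i : a \in [:: aPos; aNeg; vIdx; vC] -> m1 a i = m a i.
  by rewrite !inE => /or4P[]/eqP->; rewrite fr.
have tE m' : (m' 1 0 = m1 1 0) -> reval m' tgt = tg.
  by move=> h; rewrite tgtE // h; case: rm1 => [[]].
have eE : 1 - (digit_excess n (rev ks) r c + (digit_diff n (rev ks) r c - tg +
    (tg - digit_diff n (rev ks) r c))) = edge r c.
  rewrite /digit_edge; case: eqP => [->|?]; case: eqP => [->|?] /=; lia.
do 3 apply: run_put_seq; apply: run_put.
split.
  move=> a i; rewrite 4!inE 4!negb_or.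
  case/and5P=> /negPf A1 /negPf A2 /negPf A3 /negPf A4 A5.
  by rewrite /mem_set A1 A2 A3 A4 /= fr.
split=> [||i|i]; rewrite /mem_set /= ?tE // ?B1 ?C1 ?S1 ?eE !o ?eC ?addn1 //.
  by case: eqP => // _; case: (edge _ _); case: digit_sign.
by case: eqP => // _; case: (edge _ _); case: digit_sign.
Qed.

(** Quartic time: there are N^2 pairs, each scanned in time O(N^2), where N is the
    number of vertices. *)
Lemma main_run m : holds_input m ->
  run (main_prog tgt) m (fun m' => forall r c, r < N -> c < N ->
    m' aPos (r * N + c) = (edge r c && ~~ digit_sign n (rev ks) r c) :> nat /\
    m' aNeg (r * N + c) = (edge r c && digit_sign n (rev ks) r c) :> nat) (300 * N ^ 4).
Proof.
move=> inp.
have N0 : 0 < N by apply: leq_trans nN; exact: ltnW.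
pose good (m' : memory) x := forall r c, c < N -> r * N + c < x ->
    m' aPos (r * N + c) = (edge r c && ~~ digit_sign n (rev ks) r c) :> nat /\
    m' aNeg (r * N + c) = (edge r c && digit_sign n (rev ks) r c) :> nat.
pose I r m' := [/\ ready m', m' vR 0 = r, m' vIdx 0 = r * N & good m' (r * N)].
apply: (@run_weaken _ _ (I N) _
  (30 * N ^ 2 + (30 * N + (N * ((N * (90 * N ^ 2).+1).+1 + 1).+1.+2.+1).+1.+4).+1).+1).
- apply: run_seq; first exact: power_run.
  move=> m1 [inp1 eN1].
  apply: run_seq; first exact: table_run.
  move=> m2 rm2; do 2 apply: run_put_seq; apply: run_while.
  + split; [by do 2 apply: ready_set => // | by [] | by [] |].
    by move=> r c _; rewrite mul0n ltn0.
  + move=> r m3 rN [rm3 eR eI g3].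
    split; first by rewrite /= eR; case: rm3 => _ -> _; lia.
    apply: run_put_seq; set m4 := mem_set _ _ _ _.
    pose J c m' := [/\ ready m', m' vR 0 = r, m' vC 0 = c, m' vIdx 0 = r * N + c &
      good m' (r * N + c)].
    apply: (@run_seq _ _ _ (J N)).
      apply: run_while.
      * rewrite /J addn0; split; [exact: ready_set | by [] | by [] | by [] | exact: g3].
      * move=> c m5 cN [rm5 eR5 eC5 eI5 g5].
        split; first by rewrite /= eC5; case: rm5 => _ -> _; lia.
        apply: run_weaken (cell_run rm5 eR5 eC5 rN cN) (leqnn _) _.
        move=> m6 [fr [I6 C6 P6 Q6]]; split=> //.
        - exact: ready_frame fr _ rm5.
        - by rewrite fr.
        - by rewrite I6 eI5 addnS.
        move=> r1 c1 c1N; rewrite addnS ltnS leq_eqVlt P6 Q6 eI5.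
        have [e _|ne /= lt] := eqVneq (r1 * N + c1) (r * N + c); last exact: g5.
        have -> : r1 = r.
          by have := congr1 (divn^~ N) e; rewrite !divnMDl // !divn_small // !addn0.
        have -> // : c1 = c.
        by have := congr1 (modn^~ N) e; rewrite !modnMDl !modn_small.
      * by move=> m5 [rm5 _ eC5 _ _]; rewrite /= eC5; case: rm5 => _ -> _; rewrite subnn.
    move=> m5 [rm5 eR5 _ eI5 g5]; apply: run_put; split.
    * exact: ready_set.
    * by rewrite /mem_set /= eR5 addn1.
    * by rewrite /mem_set /= eI5 mulSn addnC.
    * by rewrite mulSn addnC.
  + by move=> m3 [rm3 eR _ _]; rewrite /= eR; case: rm3 => _ -> _; rewrite subnn.
- by move: N N0 => M M0; nia.
move=> m' [_ _ _ g] r c rN cN; apply: g => //.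
by apply: (@leq_trans (r.+1 * N)); rewrite ?leq_mul2r ?rN ?orbT // mulSn addnC ltn_add2r.
Qed.
End Run.
End RandomAccessProgram.

(** * Edge sets, Laplacians and the Loewner order *)

Section EdgeSet.
Variable V : finType.

Definition edge_set (S : rel V) : {set {set V}} :=
  [set e | [exists u : V, exists v : V, S u v && (e == [set u; v])]].

Lemma set2_eq (u v u' v' : V) : [set u; v] = [set u'; v'] ->
  u = u' /\ v = v' \/ u = v' /\ v = u'.
Proof.
move=> E.
have /set2P hu : u \in [set u'; v'] by rewrite -E set21.
have /set2P hv : v \in [set u'; v'] by rewrite -E set22.
have /set2P hu' : u' \in [set u; v] by rewrite E set21.
have /set2P hv' : v' \in [set u; v] by rewrite E set22.
case: hu => uE; case: hv => vE; subst u v; [|by left|by right|].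
  by case: hv' => ->; left.
by case: hu' => ->; left.
Qed.

Lemma mem_edge_set S (u v : V) : symmetric S -> ([set u; v] \in edge_set S) = S u v.
Proof.
move=> Ss; rewrite inE; apply/existsP/idP => [[u' /existsP[v' /andP[S' /eqP E]]]|Suv].
  by case: (set2_eq E) => -[-> ->] //; rewrite Ss.
by exists u; apply/existsP; exists v; rewrite Suv eqxx.
Qed.

Variables (A b : rel V).
Hypotheses (As : symmetric A) (bs : symmetric b).

Lemma edge_set_split :
  edge_set (fun u v => A u v && ~~ b u v) :|: edge_set (fun u v => A u v && b u v) = edge_set A.
Proof.
apply/setP => e; rewrite !inE; apply/orP/existsP.
  by case=> /existsP[u /existsP[v /andP[/andP[Auv _] ee]]]; exists u;
     apply/existsP; exists v; rewrite Auv.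
move=> [u /existsP[v /andP[Auv ee]]]; case buv: (b u v); [right|left];
by apply/existsP; exists u; apply/existsP; exists v; rewrite Auv buv.
Qed.

Lemma edge_set_disjoint :
  [disjoint edge_set (fun u v => A u v && ~~ b u v) & edge_set (fun u v => A u v && b u v)].
Proof.
rewrite -setI_eq0; apply/eqP/setP => e; rewrite in_setI in_set0.
apply/negbTE/negP => /andP[]; rewrite inE => /existsP[u /existsP[v /andP[h /eqP->]]].
by rewrite mem_edge_set => [|x y]; rewrite ?(As x) ?(bs x) //; case/andP: h => -> /negPf->.
Qed.
End EdgeSet.

Section Form.
Variables (R : realType) (V : finType).
Implicit Types (E : {set {set V}}) (x : 'cV[R]_#|V|).

Lemma laplacian_sym E : (laplacian R E)^T = laplacian R E.
Proof.
rewrite /laplacian linear_sum /=; apply: eq_bigr => u _.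
rewrite linear_sum /=; apply: eq_bigr => v _.
by rewrite trmx_mul trmxK.
Qed.

Lemma chi_form x u v :
  (x^T *m ((chi R u - chi R v) *m (chi R u - chi R v)^T) *m x) 0 0 =
  (x (enum_rank u) 0 - x (enum_rank v) 0) ^+ 2.
Proof.
have e : (chi R u - chi R v)^T *m x = (x (enum_rank u) 0 - x (enum_rank v) 0)%:M.
  rewrite linearB /= mulmxBl /chi !trmx_delta -!rowE; apply/matrixP => i j.
  by rewrite !ord1 !mxE.
rewrite mulmxA -mulmxA e -[X in X *m _]trmxK trmx_mul trmxK e.
by rewrite tr_scalar_mx -scalar_mxM mxE eqxx mulr1n expr2.
Qed.

(** The sum over all ordered pairs counts each edge twice. *)
Lemma laplacian_form E x :
  2 * (x^T *m laplacian R E *m x) 0 0 =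
  \sum_u \sum_v ([set u; v] \in E)%:R * (x (enum_rank u) 0 - x (enum_rank v) 0) ^+ 2.
Proof.
set f := fun u => x (enum_rank u) 0.
pose G u v : R := ([set u; v] \in E)%:R * (f u - f v) ^+ 2.
have Gs u v : G u v = G v u by rewrite /G setUC -opprB sqrrN.
pose H u v := (enum_rank u < enum_rank v)%N%:R * G u v.
have -> : (x^T *m laplacian R E *m x) 0 0 = \sum_u \sum_v H u v.
  rewrite /laplacian mulmx_sumr mulmx_suml summxE; apply: eq_bigr => u _.
  rewrite mulmx_sumr mulmx_suml summxE big_mkcond /=; apply: eq_bigr => v _.
  rewrite chi_form /H /G -/(f u) -/(f v).
  by case: (_ < _)%N; case: (_ \in E); rewrite ?mul0r ?mul1r ?mulr0.
transitivity (\sum_u \sum_v H u v + \sum_u \sum_v H v u).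
  by rewrite [X in _ + X]exchange_big /=; ring.
rewrite -big_split /=; apply: eq_bigr => u _; rewrite -big_split /=.
apply: eq_bigr => v _; rewrite -/(G u v) /H (Gs v u) -mulrDl.
have [e|ne] := eqVneq u v; first by rewrite e /G subrr expr0n /= !mulr0.
have := ne; rewrite -(inj_eq enum_rank_inj) -(inj_eq val_inj) neq_ltn /=.
by case: ltngtP => // _ _; rewrite ?addr0 ?add0r mul1r.
Qed.

Lemma loewner_forms (L1 L2 L : 'M[R]_#|V|) eps :
    L1^T = L1 -> L2^T = L2 -> L^T = L ->
    (forall x : 'cV[R]_#|V|, `|(x^T *m L1 *m x) 0 0 - (x^T *m L2 *m x) 0 0| <=
       eps * (x^T *m L *m x) 0 0) ->
  loewner_le (- eps *: L) (L1 - L2) /\ loewner_le (L1 - L2) (eps *: L).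
Proof.
move=> t1 t2 t h; split; split.
- by rewrite linearB /= linearB /= linearZ /= t1 t2 t.
- move=> x; have := h x; rewrite ler_norml => /andP[h1 _].
  rewrite !(mulmxBr, mulmxBl) -scalemxAr -scalemxAl !mxE.
  move: h1; rewrite !mxE; lra.
- by rewrite linearB /= linearB /= linearZ /= t1 t2 t.
- move=> x; have := h x; rewrite ler_norml => /andP[_ h1].
  rewrite !(mulmxBr, mulmxBl) -scalemxAr -scalemxAl !mxE.
  move: h1; rewrite !mxE; lra.
Qed.
End Form.

Section SignedGraph.
Variables (R : realType) (X : sgraph) (b : rel X).
Hypothesis bs : symmetric b.

Definition adj_kernel (u v : X) : R := (adj u v)%:R.
Definition signed_kernel (u v : X) : R := (-1) ^+ b u v * adj_kernel u v.

Lemma signed_partition eps D S :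
  diagonalized adj_kernel signed_kernel D S (cart_est eps D S) ->
  let E1 := edge_set (fun u v : X => adj u v && ~~ b u v) in
  let E2 := edge_set (fun u v : X => adj u v && b u v) in
  loewner_le (- eps *: laplacian R (edges X)) (laplacian R E1 - laplacian R E2) /\
  loewner_le (laplacian R E1 - laplacian R E2) (eps *: laplacian R (edges X)).
Proof.
move=> diag E1 E2; apply: loewner_forms; try exact: laplacian_sym.
move=> x; rewrite -(ler_pM2l (ltr0n R 2)) -[X in X * `|_|]ger0_norm // -normrM.
rewrite mulrBr mulrCA !laplacian_form.
set f := fun u => x (enum_rank u) 0.
have -> : \sum_u \sum_v ([set u; v] \in edges X)%:R * (f u - f v) ^+ 2 =
  \sum_u \sum_v adj_kernel u v * (f u - f v) ^+ 2.
  by apply: eq_bigr => u _; apply: eq_bigr => v _; rewrite (mem_edge_set _ _ (@adj_sym X)).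
have -> : \sum_u \sum_v ([set u; v] \in E1)%:R * (f u - f v) ^+ 2 -
    \sum_u \sum_v ([set u; v] \in E2)%:R * (f u - f v) ^+ 2 =
    \sum_u \sum_v signed_kernel u v * (f u - f v) ^+ 2.
  rewrite -sumrB; apply: eq_bigr => u _; rewrite -sumrB; apply: eq_bigr => v _.
  rewrite !mem_edge_set => [|y z|y z]; try by rewrite adj_sym bs.
  by rewrite /signed_kernel /adj_kernel; case: adj; case: b; rewrite /=; ring.
exact: energy_le diag.
Qed.
End SignedGraph.

(** * Adjacency in products of circulant graphs, read off digits *)

Section Digits.
Variable n : nat.
Hypothesis n0 : (0 < n)%N.
Implicit Types (l : seq nat).

Lemma digit_signC l r r' : digit_sign n l r r' = digit_sign n l r' r.
Proof. by elim: l r r' => //= k l IH r r'; rewrite circ_distC IH. Qed.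

Lemma digit_diff_le l r r' : (digit_diff n l r r' <= size l)%N.
Proof. by elim: l r r' => //= k l IH r r'; rewrite -[(size l).+1]add1n leq_add ?leq_b1. Qed.

(** Distance 0 neither exceeds a bound nor carries a sign. *)
Lemma digit_diff0 l r r' : digit_diff n l r r' = 0%N ->
  digit_excess n l r r' = 0%N /\ digit_sign n l r r' = false.
Proof.
elim: l r r' => //= k l IH r r' /eqP; rewrite addn_eq0 eqb0 -eqn0Ngt.
move=> /andP[/eqP-> /eqP/IH[-> ->]]; by [].
Qed.

Lemma divn_digit a i : (i < n)%N -> ((a * n + i) %/ n = a)%N.
Proof. by move=> i_n; rewrite divnMDl // divn_small ?addn0. Qed.

Lemma modn_digit a i : (i < n)%N -> ((a * n + i) %% n = i)%N.
Proof. by move=> i_n; rewrite modnMDl modn_small. Qed.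
End Digits.

Section Circulants.
Variable m : nat.
Local Notation n := m.+2.

Lemma rank_ord (i : 'I_n) : enum_rank i = i :> nat.
Proof. by rewrite enum_rank_ord. Qed.

(** In coordinates: x is a generator iff x or n - x is at most k. *)
Lemma mem_pm_set k (x : 'Z_n) : (2 * k < n)%N ->
  (x \in pm_set n k) = (0 < minn x (n - x) <= k)%N.
Proof.
move=> kn; have xn : (x < n)%N := ltn_ord x.
have x0 : (x != 0) = (0 < x)%N by rewrite -(inj_eq val_inj) lt0n.
rewrite inE x0; apply/andP/idP => [[xp /hasP[j]]|].
  rewrite mem_iota => jk /orP[]/eqP xE; move: xp; rewrite {}xE Zp_nat /=.
    by change ((Zp_trunc n).+2) with n; rewrite modn_small; lia.
  change ((Zp_trunc n).+2) with n; rewrite [(j %% n)%N]modn_small; last by lia.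
  by rewrite modn_small; lia.
move=> h; split; first by lia.
have [xk|xk] := leqP x k.
  by apply/hasP; exists (x : nat); [rewrite mem_iota; lia | rewrite natr_Zp eqxx].
apply/hasP; exists (n - x)%N; first by rewrite mem_iota; lia.
rewrite natrB ?(ltnW xn) // natr_Zp.
have -> : (n%:R : 'Z_n) = 0 by apply: val_inj; rewrite Zp_nat /= modnn.
by rewrite sub0r opprK eqxx orbT.
Qed.

Lemma adj_circulant k (u v : pm_circulant n k) : (2 * k < n)%N ->
  adj u v = (0 < circ_dist n (u : 'I_n) (v : 'I_n) <= k)%N.
Proof.
move=> kn; rewrite -[LHS]/((u - v : 'Z_n) \in pm_set n k) mem_pm_set //.
by rewrite -(circ_dist_shift (v : 'I_n)) addrC subrK circ_distC.
Qed.

Lemma circ_dist_eq0 (u v : 'I_n) : (circ_dist n u v == 0%N) = (u == v).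
Proof.
rewrite -(inj_eq val_inj) /circ_dist /=; have := ltn_ord u; have := ltn_ord v => h1 h2.
by apply/eqP/eqP; lia.
Qed.

(** The numbering of vertices separates points; the equality test is needed to
    describe adjacency in a Cartesian product. *)
Definition digit_diff_eq (X : finType) (ks : seq nat) : Prop :=
  #|X| = (n ^ size ks)%N /\
  forall u v : X, (u == v) = (digit_diff n (rev ks) (enum_rank u) (enum_rank v) == 0%N).

Definition adj_digits (tg : nat) (X : sgraph) (ks : seq nat) : Prop :=
  forall u v : X, adj u v = digit_edge n (rev ks) tg (enum_rank u) (enum_rank v).

Definition edge_sign (ks : seq nat) (X : sgraph) (u v : X) : bool :=
  digit_sign n (rev ks) (enum_rank u) (enum_rank v).

Lemma edge_sign_sym ks X : symmetric (@edge_sign ks X).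
Proof. by move=> u v; rewrite /edge_sign digit_signC. Qed.

Section Step.
Variables (k : nat) (kn : (2 * k < n)%N) (G : sgraph) (ks : seq nat).
Local Notation c := (pm_circulant n k).
Implicit Types (u v : G * c).

Lemma rank_pair (u : G * c) :
  enum_rank u = (enum_rank u.1 * n + (u.2 : 'I_n))%N :> nat.
Proof. by case: u => u w; rewrite enum_rank_pair /= (rank_ord w) card_ord. Qed.

Let dv (u : G * c) : (enum_rank u %/ n = enum_rank u.1)%N.
Proof. by rewrite rank_pair divn_digit. Qed.

Let md (u : G * c) : (enum_rank u %% n = (u.2 : 'I_n))%N.
Proof. by rewrite rank_pair modn_digit. Qed.

Lemma digit_diff_rcons (u v : G * c) :
  digit_diff n (rev (rcons ks k)) (enum_rank u) (enum_rank v) =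
  ((0 < circ_dist n (u.2 : 'I_n) (v.2 : 'I_n)) +
   digit_diff n (rev ks) (enum_rank u.1) (enum_rank v.1))%N.
Proof. by rewrite rev_rcons /= !dv !md. Qed.

Lemma digit_excess_rcons (u v : G * c) :
  digit_excess n (rev (rcons ks k)) (enum_rank u) (enum_rank v) =
  ((circ_dist n (u.2 : 'I_n) (v.2 : 'I_n) - k) +
   digit_excess n (rev ks) (enum_rank u.1) (enum_rank v.1))%N.
Proof. by rewrite rev_rcons /= !dv !md. Qed.

Lemma digit_sign_rcons (u v : G * c) :
  digit_sign n (rev (rcons ks k)) (enum_rank u) (enum_rank v) =
  dist_sign (circ_dist n (u.2 : 'I_n) (v.2 : 'I_n)) (+)
   digit_sign n (rev ks) (enum_rank u.1) (enum_rank v.1).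
Proof. by rewrite rev_rcons /= !dv !md. Qed.

Lemma digit_diff_eq_step :
  digit_diff_eq G ks -> digit_diff_eq (G * c)%type (rcons ks k).
Proof.
move=> [cG dG]; split; first by rewrite card_prod cG card_ord size_rcons expnSr.
move=> u v; rewrite digit_diff_rcons addn_eq0 -dG eqb0 -eqn0Ngt circ_dist_eq0.
by case: u v => [u w] [v x]; rewrite xpair_eqE andbC.
Qed.

Lemma tensor_digits_step : adj_digits (size ks) G ks ->
  adj_digits (size (rcons ks k)) (tensor_prod G c) (rcons ks k).
Proof.
move=> aG u v; rewrite -[LHS]/(adj u.1 v.1 && adj u.2 v.2) aG adj_circulant //.
rewrite /digit_edge digit_diff_rcons digit_excess_rcons size_rcons.
have := digit_diff_le n (rev ks) (enum_rank u.1) (enum_rank v.1); rewrite size_rev.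
move: (circ_dist _ _ _) (digit_diff _ _ _ _) (digit_excess _ _ _ _) => e x y xs.
by apply/idP/idP; lia.
Qed.

Lemma cart_digits_step : digit_diff_eq G ks -> adj_digits 1 G ks ->
  adj_digits 1 (cart_prod G c) (rcons ks k).
Proof.
move=> [_ dG] aG u v.
rewrite -[LHS]/(((u.1 == v.1) && adj u.2 v.2) || (adj u.1 v.1 && (u.2 == v.2))).
rewrite aG adj_circulant // -[u.2 == v.2]circ_dist_eq0 dG.
rewrite /digit_edge digit_diff_rcons digit_excess_rcons.
have := @digit_diff0 n (rev ks) (enum_rank u.1) (enum_rank v.1).
move: (circ_dist _ _ _) (digit_diff _ _ _ _) (digit_excess _ _ _ _) => e x y xs.
case: (eqVneq x 0%N) => [x0|x0]; first by have [-> _] := xs x0; rewrite x0; apply/idP/idP; lia.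
by apply/idP/idP; lia.
Qed.

Variable R : realType.
Local Notation A X := (@adj_kernel R X).
Local Notation W X ks := (@signed_kernel R X (@edge_sign ks X)).
Local Notation cA := (fun u v : 'I_n => adj_weight R k (circ_dist n u v)).
Local Notation cW := (fun u v : 'I_n => signed_weight R k (circ_dist n u v)).

Lemma adj_kernel_tensor (u v : tensor_prod G c) : A _ u v = tensor_kernel (A G) cA u v.
Proof.
by rewrite /adj_kernel /tensor_kernel /adj_weight -adj_circulant // -natrM mulnb.
Qed.

Lemma signed_kernel_tensor (u v : tensor_prod G c) :
  W _ (rcons ks k) u v = tensor_kernel (W G ks) cW u v.
Proof.
rewrite /signed_kernel adj_kernel_tensor /tensor_kernel /signed_weight.
by rewrite /edge_sign digit_sign_rcons signr_addb; ring.
Qed.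

Lemma adj_kernel_cart (u v : cart_prod G c) : A _ u v = cart_kernel (A G) cA u v.
Proof.
rewrite /adj_kernel /cart_kernel /tensor_kernel /adj_weight -adj_circulant //.
rewrite -[@adj (cart_prod G c) u v]/
  (((u.1 == v.1) && adj u.2 v.2) || (adj u.1 v.1 && (u.2 == v.2))).
rewrite -!natrM !mulnb -natrD.
case: eqVneq => [->|_] /=; first by rewrite adj_irr add0n orbF.
by rewrite addn0.
Qed.

Lemma signed_kernel_cart (u v : cart_prod G c) : digit_diff_eq G ks ->
  W _ (rcons ks k) u v = cart_kernel (W G ks) cW u v.
Proof.
move=> [_ dG]; rewrite /signed_kernel adj_kernel_cart /cart_kernel /tensor_kernel.
rewrite /signed_weight /edge_sign digit_sign_rcons signr_addb.
rewrite /id_kernel -!/(adj_kernel R _ _) mulrDr; congr (_ + _).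
  have [e|ne] := eqVneq u.2 v.2; last by rewrite !mulr0.
  have /eqP e0 : circ_dist n (u.2 : 'I_n) (v.2 : 'I_n) == 0%N by rewrite circ_dist_eq0 e.
  by rewrite e0 /dist_sign /= expr0 mul1r mulrA.
have [e|ne] := eqVneq u.1 v.1; last by rewrite !mul0r mulr0.
have /eqP /digit_diff0[_ ->] : digit_diff n (rev ks) (enum_rank u.1) (enum_rank v.1) == 0%N.
  by rewrite -dG e.
by rewrite expr0 mulr1 !mul1r.
Qed.
End Step.

Lemma digit_diff_eq_circulant k : digit_diff_eq (pm_circulant n k) [:: k].
Proof.
split; first by rewrite card_ord expn1.
move=> u v; rewrite /= !rank_ord !modn_small ?ltn_ord // addn0 eqb0 -eqn0Ngt.
by rewrite circ_dist_eq0.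
Qed.

Lemma adj_digits_circulant k : (2 * k < n)%N -> adj_digits 1 (pm_circulant n k) [:: k].
Proof.
move=> kn u v; rewrite adj_circulant // /digit_edge /= !rank_ord !modn_small ?ltn_ord // !addn0.
by move: (circ_dist _ _ _) => e; apply/idP/idP; lia.
Qed.

Lemma edge_sign_circulant k (u v : pm_circulant n k) :
  edge_sign [:: k] u v = dist_sign (circ_dist n (u : 'I_n) (v : 'I_n)).
Proof. by rewrite /edge_sign /= !rank_ord !modn_small ?ltn_ord // addbF. Qed.

(** The iterated product associates to the left, so factors are appended at the
    end of the list; the accumulated factors are generalized in the induction. *)
Lemma iter_prod_ind (op : sgraph -> sgraph -> sgraph) (Inv : sgraph -> seq nat -> Prop)
    (Q : pred nat) (ks : seq nat) :
  (forall k, Q k -> Inv (pm_circulant n k) [:: k]) ->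
  (forall G ls k, Q k -> Inv G ls ->
     Inv (op G (pm_circulant n k)) (rcons ls k)) ->
  all Q ks -> ks != [::] ->
  Inv (iter_prod op [seq pm_circulant n k | k <- ks]) ks.
Proof.
move=> base step; case: ks => //= k ks /andP[kn kns] _.
have : Inv (pm_circulant n k) [:: k] by exact: base.
rewrite -[k :: ks]/([:: k] ++ ks); elim: ks [:: k] (pm_circulant n k) kns => [|l ks IH] ls G /=.
  by rewrite cats0.
by move=> /andP[ln lns] h; rewrite -cat_rcons; apply: IH => //; exact: step.
Qed.
End Circulants.

(** * Assembling the two products *)

Section Final.
Variable R : realType.

Lemma diagonalized_ext (V : finType) (A A' W W' : V -> V -> R) D S P :
  A =2 A' -> W =2 W' -> diagonalized A' W' D S P -> diagonalized A W D S P.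
Proof.
move=> EA EW [As Ws AD WS [I [phi [a [b [pC eA eW ab]]]]]]; split.
- by move=> u v; rewrite !EA.
- by move=> u v; rewrite !EW.
- by move=> u; rewrite -(AD u); apply: eq_bigr => v _; rewrite EA.
- by move=> u; rewrite -(WS u); apply: eq_bigr => v _; rewrite EW.
exists I, phi, a, b; split=> //.
- by move=> i u; rewrite -eA; apply: eq_bigr => v _; rewrite EA.
- by move=> i u; rewrite -eW; apply: eq_bigr => v _; rewrite EW.
Qed.

Section Fixed.
Variable m : nat.
Local Notation n := m.+2.
Local Notation good := (fun k => (0 < k)%N && (2 * k < n)%N).

Lemma diagonalized_circulant k P : (2 * k < n)%N ->
  (forall z : R[i], Normc.normc z = 1 ->
    P (\sum_(j < k) dcos z j.+1) (\sum_(j < k) rs_sign j * dcos z j.+1)) ->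
  diagonalized (@adj_kernel R (pm_circulant n k))
    (@signed_kernel R _ (@edge_sign m [:: k] (pm_circulant n k)))
    (2 * k%:R) (2 * \sum_(j < k) rs_sign j) P.
Proof.
move=> kn PE; have := diagonalized_cyclic kn PE.
have EA (u v : pm_circulant n k) :
    adj_kernel R u v = adj_weight R k (circ_dist n (u : 'I_n) (v : 'I_n)).
  by rewrite /adj_kernel adj_circulant.
apply: diagonalized_ext => // u v.
by rewrite /signed_kernel EA edge_sign_circulant.
Qed.

(** Common to both products: digits describe adjacency for the program, and the
    eigenvalue estimate gives both Loewner inequalities. *)
Lemma partition_exists (d : nat) (k : d.-tuple nat) (X : sgraph) tgt tg eps D S :
    (0 < d)%N ->
    (forall mm : memory, mm 1%N 0%N = d -> reval mm tgt = tg) ->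
    digit_diff_eq m X k -> adj_digits m tg X k ->
    diagonalized (@adj_kernel R X) (@signed_kernel R X (@edge_sign m k X)) D S
      (cart_est eps D S) ->
  exists E1 E2 : {set {set X}},
    [/\ E1 :|: E2 = edges X, [disjoint E1 & E2],
        computes_partition (main_prog tgt) n k E1 E2 (300 * #|X| ^ 4)%N,
        loewner_le (- eps *: laplacian R (edges X)) (laplacian R E1 - laplacian R E2) &
        loewner_le (laplacian R E1 - laplacian R E2) (eps *: laplacian R (edges X))].
Proof.
move=> d0 tgtE [cX _] aX diag.
have bs : symmetric (@edge_sign m k X) := @edge_sign_sym _ _ _.
exists (edge_set (fun u v : X => adj u v && ~~ edge_sign m k u v)),
  (edge_set (fun u v : X => adj u v && edge_sign m k u v)).
have [lo up] := signed_partition bs diag.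
split=> //.
- exact: edge_set_split.
- exact: edge_set_disjoint (@adj_sym X) bs.
have inp : holds_input n d k (input_memory n k) by split.
rewrite cX size_tuple.
have [m' [t [ex le res]]] := @main_run n d k isT d0 (size_tuple k) tgt tg tgtE _ inp.
have rk (u : X) : (enum_rank u < n ^ d)%N.
  by rewrite (leq_trans (ltn_ord _)) // cX size_tuple.
have idx i j : (i * #|X| + j = i * n ^ d + j)%N by rewrite cX size_tuple.
exists m', t; split=> //; move=> u v; rewrite idx.
  have [-> _] := res _ _ (rk u) (rk v).
  by rewrite mem_edge_set => [|x y]; rewrite ?aX // -!aX adj_sym bs.
have [_ ->] := res _ _ (rk u) (rk v).
by rewrite mem_edge_set => [|x y]; rewrite ?aX // -!aX adj_sym bs.
Qed.

Definition tensor_inv (X : sgraph) (ks : seq nat) : Prop :=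
  [/\ digit_diff_eq m X ks, adj_digits m (size ks) X ks &
    let D : R := \prod_(k <- ks) (2 * k%:R) in
    let S : R := \prod_(k <- ks) (2 * \sum_(j < k) rs_sign j) in
    diagonalized (@adj_kernel R X) (@signed_kernel R X (@edge_sign m ks X)) D S
      (tensor_est (\prod_(k <- ks) (abs_const R * (2 * Num.sqrt k%:R))) D S)].

Lemma tensor_inv_all ks : all good ks -> ks != [::] ->
  tensor_inv (iter_prod tensor_prod [seq pm_circulant n k | k <- ks]) ks.
Proof.
apply: (iter_prod_ind (Q := good)) => [k /andP[k0 kn]|G ls k /andP[k0 kn] [dG aG diag]].
  split; [exact: digit_diff_eq_circulant | exact: adj_digits_circulant |].
  rewrite !big_seq1; apply: diagonalized_circulant => // z z1; exact: tensor_est_circle.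
split; [exact: digit_diff_eq_step | exact: tensor_digits_step |].
rewrite -cats1 !big_cat !big_seq1 /= cats1.
have base := diagonalized_cyclic kn (fun (z : R[i]) z1 => tensor_est_circle z1 k0).
have est := diagonalized_tensor (fun a b a' b' => @tensor_estM R _ _ _ _ _ _ a a' b b') diag base.
by apply: diagonalized_ext est => u v; [exact: adj_kernel_tensor | exact: signed_kernel_tensor].
Qed.

Definition cart_inv (eps : R) (X : sgraph) (ks : seq nat) : Prop :=
  [/\ digit_diff_eq m X ks, adj_digits m 1 X ks &
    exists D S, diagonalized (@adj_kernel R X) (@signed_kernel R X (@edge_sign m ks X)) D S
      (cart_est eps D S)].

(** Replacing sqrt k by the smaller number sqrt k0 weakens the bound. *)
Lemma cart_est_min k0 k (z : R[i]) : (0 < k0 <= k)%N -> Normc.normc z = 1 ->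
  cart_est (abs_const R / Num.sqrt k0%:R) (2 * k%:R) (2 * \sum_(j < k) rs_sign j)
    (\sum_(j < k) dcos z j.+1) (\sum_(j < k) rs_sign j * dcos z j.+1).
Proof.
rewrite /cart_est; move=> /andP[k00 k0k] z1; have k1 : (0 < k)%N := leq_trans k00 k0k.
have r0 : 0 < Num.sqrt k0%:R :> R by rewrite sqrtr_gt0 ltr0n.
have rk : Num.sqrt k0%:R <= Num.sqrt k%:R :> R by rewrite ler_wsqrtr ?ler_nat.
rewrite mulrAC ler_pdivlMr // [leLHS]mulrC.
apply: le_trans (cart_est_circle z1 k).
by rewrite ler_wpM2r.
Qed.

Lemma cart_inv_all k0 ks : (0 < k0)%N ->
  all (fun k => (k0 <= k)%N && (2 * k < n)%N) ks -> ks != [::] ->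
  cart_inv (abs_const R / Num.sqrt k0%:R) (iter_prod cart_prod [seq pm_circulant n k | k <- ks]) ks.
Proof.
move=> k00; apply: iter_prod_ind => [k /andP[k0k kn]|G ls k /andP[k0k kn] [dG aG [D [S diag]]]].
  split; [exact: digit_diff_eq_circulant | exact: adj_digits_circulant |].
  exists (2 * k%:R), (2 * \sum_(j < k) rs_sign j).
  by apply: diagonalized_circulant => // z z1; apply: cart_est_min => //; rewrite k00.
split; [exact: digit_diff_eq_step | exact: cart_digits_step |].
exists (D + 2 * k%:R), (S + 2 * \sum_(j < k) rs_sign j).
have base := diagonalized_cyclic kn
  (fun (z : R[i]) z1 => @cart_est_min k0 k z (introT andP (conj k00 k0k)) z1).
have est := diagonalized_cart
  (fun a b a' b' => @cart_estD R _ _ _ _ _ a a' b b') diag base.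
by apply: diagonalized_ext est => u v; [exact: adj_kernel_cart | exact: signed_kernel_cart].
Qed.
End Fixed.

Lemma bigminn_le n (s : seq nat) x : x \in s -> (\big[minn/n]_(y <- s) y <= x)%N.
Proof.
elim: s => //= y s IH; rewrite inE big_cons geq_min.
by case/orP=> [/eqP->|/IH->]; rewrite ?leqnn ?orbT.
Qed.

Lemma bigminn_gt0 n (s : seq nat) : (0 < n)%N -> all (leq 1) s ->
  (0 < \big[minn/n]_(y <- s) y)%N.
Proof.
move=> n0; elim: s => [|y s IH] /=; first by rewrite big_nil.
by move=> /andP[y0 /IH h]; rewrite big_cons leq_min y0.
Qed.

Lemma sqrt_prod (s : seq nat) :
  Num.sqrt (\prod_(k <- s) k)%N%:R = \prod_(k <- s) Num.sqrt k%:R :> R.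
Proof.
elim: s => [|k s IH]; first by rewrite !big_nil sqrtr1.
by rewrite !big_cons natrM sqrtrM // IH.
Qed.

(** The quotient q / D of the parameters accumulated in tensor_est. *)
Lemma tensor_constant (s : seq nat) : all (leq 1) s ->
  (\prod_(k <- s) (abs_const R * (2 * Num.sqrt k%:R))) / (\prod_(k <- s) (2 * k%:R)) =
  abs_const R ^+ size s / Num.sqrt (\prod_(k <- s) k)%N%:R.
Proof.
rewrite sqrt_prod; elim: s => [|k s IH]; first by rewrite !big_nil.
move=> /= /andP[k0 /IH h]; rewrite !big_cons -mulf_div h exprS -[RHS]mulf_div.
congr (_ * _).
have r0 : Num.sqrt k%:R != 0 :> R by rewrite gt_eqF // sqrtr_gt0 ltr0n.
have e : k%:R = Num.sqrt k%:R ^+ 2 :> R by rewrite sqr_sqrtr.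
by rewrite [X in _ / (2 * X)]e; move: (Num.sqrt k%:R) r0 => r r0; field.
Qed.
End Final.

Theorem theorem5p1 (R : realType) :
  exists2 c : R, 0 < c &
    (exists (p : rcmd) (C e : nat), forall (n d : nat) (k : d.-tuple nat),
      (0 < n)%N -> (0 < d)%N ->
      (forall h : 'I_d, (0 < tnth k h <= (n - 1) %/ 2)%N) ->
      let X := iter_prod cart_prod [seq pm_circulant n j | j <- k] in
      let LX := laplacian R (edges X) in
      exists E1 E2 : {set {set X}},
        [/\ E1 :|: E2 = edges X,
            [disjoint E1 & E2],
            computes_partition p n k E1 E2 (C * #|X| ^ e)%N,
            loewner_le (- (c / Num.sqrt (k_min n k)%:R) *: LX)
                       (laplacian R E1 - laplacian R E2)
          & loewner_le (laplacian R E1 - laplacian R E2)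
                       (c / Num.sqrt (k_min n k)%:R *: LX)])
    /\
    (exists (p : rcmd) (C e : nat), forall (n d : nat) (k : d.-tuple nat),
      (0 < n)%N -> (0 < d)%N ->
      (forall h : 'I_d, (0 < tnth k h <= (n - 1) %/ 2)%N) ->
      let X := iter_prod tensor_prod [seq pm_circulant n j | j <- k] in
      let K := (\prod_(h < d) tnth k h)%N in
      let LX := laplacian R (edges X) in
      exists E1 E2 : {set {set X}},
        [/\ E1 :|: E2 = edges X,
            [disjoint E1 & E2],
            computes_partition p n k E1 E2 (C * #|X| ^ e)%N,
            loewner_le (- (c ^+ d / Num.sqrt K%:R) *: LX)
                       (laplacian R E1 - laplacian R E2)
          & loewner_le (laplacian R E1 - laplacian R E2)
                       (c ^+ d / Num.sqrt K%:R *: LX)]).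
Proof.
have size_n n d (k : d.-tuple nat) : (0 < d)%N ->
    (forall h : 'I_d, (0 < tnth k h <= (n - 1) %/ 2)%N) ->
    exists2 m, n = m.+2 & all (fun j => (0 < j)%N && (2 * j < m.+2)%N) k.
  move=> d0 hk; have := hk (Ordinal d0); case: n hk => [|[|m]] hk.
  - by move: (tnth _ _) => j; rewrite div0n; lia.
  - by move: (tnth _ _) => j; rewrite div0n; lia.
  move=> _; exists m => //; apply/all_tnthP => h; have := hk h.
  by move: (tnth _ _) => j; lia.
have nnil d (k : d.-tuple nat) : (0 < d)%N -> val k != [::].
  by move=> d0; rewrite -size_eq0 size_tuple -lt0n.
exists (abs_const R); first by rewrite /abs_const; lra.
split.
  exists (main_prog (RConst 1)), 300%N, 4%N => n d k n0 d0 hk X LX.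
  have [m nE gk] := size_n n d k d0 hk; subst n.
  have kmin0 : (0 < k_min m.+2 k)%N.
    have -> : k_min m.+2 k = \big[minn/m.+2]_(j <- k) j by rewrite big_tuple.
    apply: bigminn_gt0 => //.
    by apply: sub_all gk => j /andP[].
  have gk' : all (fun j => (k_min m.+2 k <= j)%N && (2 * j < m.+2)%N) k.
    apply/allP => j jk; have /andP[_ ->] := allP gk j jk; rewrite andbT.
    have -> : k_min m.+2 k = \big[minn/m.+2]_(j <- k) j by rewrite big_tuple.
    exact: bigminn_le.
  have [dX aX [D [S diag]]] := cart_inv_all R kmin0 gk' (nnil _ k d0).
  exact: (partition_exists (tgt := RConst 1) d0 _ dX aX diag).
exists (main_prog (RGet 1 (RConst 0))), 300%N, 4%N => n d k n0 d0 hk X K LX.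
have [m nE gk] := size_n n d k d0 hk; subst n.
have [dX aX diag] := tensor_inv_all R gk (nnil _ k d0).
have gk1 : all (leq 1) k by apply: sub_all gk => j /andP[].
apply: (partition_exists (tgt := RGet 1 (RConst 0)) (tg := size k) d0 _ dX aX).
  by move=> mm /= ->; rewrite size_tuple.
apply: diagonalized_imp diag => a b [[D0 _] _ _ est _].
have -> : abs_const R ^+ d / Num.sqrt K%:R =
   (\prod_(j <- k) (abs_const R * (2 * Num.sqrt j%:R))) / (\prod_(j <- k) (2 * j%:R)).
  by rewrite tensor_constant // size_tuple /K big_tuple.
by rewrite /cart_est mulrAC ler_pdivlMr.
Qed.
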